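(* The isometry group $\mathrm{Isom}(\mathbb{U}_1)$ of the bounded Urysohn space $\mathbb{U}_1$ of diameter $1$ is abstractly simple, i.e. simple as an abstract group (it is nontrivial and its only normal subgroups are the trivial subgroup and the whole group).
   Context: The bounded Urysohn space $\mathbb{U}_1$ of diameter $1$ is the (unique up to isometry) complete separable metric space of diameter $1$ which is homogeneous (every isometry between finite subsets extends to an isometry of the whole space onto itself) and embeds isometrically every finite metric space of diameter at most $1$. $\mathrm{Isom}(\mathbb{U}_1)$ is the group of all isometries of $\mathbb{U}_1$ onto itself. *)

(* Defs.v *)
From HB Require Import structures.
From mathcomp Require Import all_boot all_order all_algebra.
From mathcomp Require Import all_classical all_reals all_analysis.

Set Implicit Arguments.
Unset Strict Implicit.
Unset Printing Implicit Defensive.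

Import Order.TTheory GRing.Theory Num.Theory.

Local Open Scope classical_set_scope.
Local Open Scope ring_scope.

Section AbstractGroups.
Variable G : groupType.
Local Open Scope group_scope.

Definition subgroup (H : set G) : Prop :=
  [/\ H 1, (forall x y, H x -> H y -> H (x * y)) &
      (forall x, H x -> H x^-1)].

Definition normal_subgroup (N : set G) : Prop :=
  subgroup N /\ (forall x g, N x -> N (x ^ g)).

Definition simple_group : Prop :=
  (exists g : G, g <> 1) /\
  (forall N : set G, normal_subgroup N -> N = [set 1] \/ N = setT).

End AbstractGroups.

Section Isometries.
Variable R : realType.

Definition isometric_on (S T : metricType R) (A : set S) (f : S -> T) : Prop :=
  forall x y, A x -> A y -> mdist (f x) (f y) = mdist x y.

(* The empty space has diameter -oo. *)
Definition diam (T : metricType R) : \bar R :=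
  ereal_sup [set (mdist xy.1 xy.2)%:E | xy in [set: T * T]].

Record isom (T : metricType R) := Isom {
  isom_fun :> T -> T ;
  isomP : isometric_on setT isom_fun ;
  isom_surj : forall y, exists x, isom_fun x = y }.

HB.instance Definition _ (T : metricType R) := gen_eqMixin (isom T).
HB.instance Definition _ (T : metricType R) := gen_choiceMixin (isom T).

Section IsomGroup.
Variable T : metricType R.
Implicit Types f g h : isom T.

Lemma isom_ext f g : f =1 g -> f = g.
Proof.
case: f g => [f f1 f2] [g g1 g2] /= /funext fg.
by subst g; congr Isom; exact: Prop_irrelevance.
Qed.

Lemma isom_inj f : injective f.
Proof.
move=> x y fxy; apply: mdist_positivity.
by rewrite -(isomP f)// fxy mdistxx.
Qed.

Lemma isom_id_proof : isometric_on setT (@id T). Proof. by []. Qed.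

Lemma isom_id_surj (y : T) : exists x, id x = y. Proof. by exists y. Qed.

Definition isom_id : isom T := Isom isom_id_proof isom_id_surj.

Lemma isom_comp_proof f g : isometric_on setT (f \o g).
Proof. by move=> x y _ _ /=; rewrite !isomP. Qed.

Lemma isom_comp_surj f g y : exists x, (f \o g) x = y.
Proof.
have [z <-] := isom_surj f y; have [x <-] := isom_surj g z.
by exists x.
Qed.

Definition isom_comp f g : isom T :=
  Isom (isom_comp_proof f g) (@isom_comp_surj f g).

Definition isom_inv_fun f (y : T) : T := sval (cid (isom_surj f y)).

Lemma isom_inv_funK f y : f (isom_inv_fun f y) = y.
Proof. by rewrite /isom_inv_fun; case: cid. Qed.

Lemma isom_funK f x : isom_inv_fun f (f x) = x.
Proof. by apply: (@isom_inj f); rewrite isom_inv_funK. Qed.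

Lemma isom_inv_proof f : isometric_on setT (isom_inv_fun f).
Proof. by move=> x y _ _; rewrite -(isomP f)// !isom_inv_funK. Qed.

Lemma isom_inv_surj f y : exists x, isom_inv_fun f x = y.
Proof. by exists (f y); rewrite isom_funK. Qed.

Definition isom_inv f : isom T := Isom (isom_inv_proof f) (@isom_inv_surj f).

Lemma isom_compA : associative isom_comp.
Proof. by move=> f g h; apply: isom_ext. Qed.

Lemma isom_comp1f : left_id isom_id isom_comp.
Proof. by move=> f; apply: isom_ext. Qed.

Lemma isom_compf1 : right_id isom_id isom_comp.
Proof. by move=> f; apply: isom_ext. Qed.

Lemma isom_compVf : left_inverse isom_id isom_inv isom_comp.
Proof. by move=> f; apply: isom_ext => x /=; rewrite isom_funK. Qed.

Lemma isom_compfV : right_inverse isom_id isom_inv isom_comp.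
Proof. by move=> f; apply: isom_ext => x /=; rewrite isom_inv_funK. Qed.

HB.instance Definition _ := isGroup.Build (isom T)
  isom_compA isom_comp1f isom_compf1 isom_compVf isom_compfV.

End IsomGroup.

Definition complete_space (T : metricType R) : Prop :=
  forall F : set_system T, ProperFilter F -> cauchy F -> exists x : T, F --> x.

Definition separable_space (T : metricType R) : Prop :=
  exists D : set T, countable D /\ dense D.

(* An isometry between finite subsets is given by a total function f, of which
   only the restriction to A matters; its target set is the image of A. *)
Definition homogeneous_space (T : metricType R) : Prop :=
  forall (A : set T) (f : T -> T), finite_set A -> isometric_on A f ->
    exists g : isom T, forall x, A x -> g x = f x.

Definition embeds_finite_spaces (T : metricType R) : Prop :=
  forall S : metricType R, finite_set [set: S] -> (diam S <= 1)%E ->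
    exists f : S -> T, isometric_on setT f.

Record is_bounded_urysohn (U : metricType R) : Prop := {
  urysohn_complete : complete_space U ;
  urysohn_separable : separable_space U ;
  urysohn_diam : diam U = 1%E ;
  urysohn_homogeneous : homogeneous_space U ;
  urysohn_universal : embeds_finite_spaces U }.

End Isometries.

(* Main.v *)
Require Import Defs.
From HB Require Import structures.
From mathcomp Require Import all_boot all_order all_algebra.
From mathcomp Require Import all_classical all_reals all_analysis.
From mathcomp Require Import lra.

(** Let N be a nontrivial normal subgroup. The proof adapts the method of Tent and
    Ziegler, whose basic notion is the independence of two points over a finite
    set C: their distance is the largest one that their distances to C and the
    bound 1 permit ([indep]).

    N is transitive, because its orbit relation contains some positive distance
    and can double distances ([normal_transitive]). So some g in N moves a point by
    1, and the commutator of g with a suitable isometry of displacement at most 1/4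
    moves every point by at most 1/2 and some point by exactly 1/2
    ([normal_half_isom]). Replace g by this commutator. That the bound 1/2 is
    attained has a strong consequence: every finite type has a realization c for
    which the distance from c to g c is the smaller of 1/2 and the largest value
    that the triangle inequality allows ([free_image]).

    It is then enough to write an arbitrary isometry f as a quotient of two
    products of six conjugates of g. Regard such a product as a chain: a point of
    level 0 travels through the levels 1 to 6. The central fact
    ([dense_near_exists]) is that the product map is somewhere dense on each
    neighbourhood: given conjugators frozen on a finite set A, there is a finite set
    X such that, after a change of the conjugators off A, every isometry that agrees
    with the product on X is matched by products on arbitrary finite sets. Its proof
    has two parts.

    - The chain can be put in general position over A ([generic_next]): each level
      depends on earlier ones through the preceding level only, and a step shorter
      than 1/2 is due to the frozen part. Two consecutive short steps can only
      meet through A, so four steps cost at least 1 or pass through A, and levels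
      that are four steps apart are independent over A ([decay]).
    - For a chain in that position, let a be a new point of level 0 and a' its
      prescribed image at level 6. Re-embed the interior levels freely over the two
      ends ([interior_moved]), then join a to a' by points that are as free as
      possible ([chain_points]). Two steps of length 1/2 add up to the diameter;
      this makes the two halves of the new orbit fit together. By [free_image] the
      pairs of consecutive points are realized by conjugates of the steps
      ([step_through]).

    An alternating construction of two chains ([quotient_of_products]) now yields in
    the limit two products whose quotient is f: density lets each chain catch up
    with the other after the latter has been frozen on a larger finite set. *)

Set Implicit Arguments.
Unset Strict Implicit.
Unset Printing Implicit Defensive.

Import Order.TTheory GRing.Theory Num.Theory.

Local Open Scope classical_set_scope.
Local Open Scope ring_scope.

Local Notation d := mdist.

(** * Isometries and distances *)

Section MetricBasics.
Context {R : realType} {U : metricType R}.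
Implicit Types (x y z : U) (f g k : isom U).

Lemma isomM f g x : (f * g)%g x = f (g x). Proof. by []. Qed.

Lemma isom1 x : (1%g : isom U) x = x. Proof. by []. Qed.

Lemma isomK f x : (f^-1)%g (f x) = x. Proof. exact: isom_funK. Qed.

Lemma isomVK f x : f ((f^-1)%g x) = x. Proof. exact: isom_inv_funK. Qed.

Lemma isomJ f k x : (f ^ k)%g x = (k^-1)%g (f (k x)).
Proof. by rewrite conjgE. Qed.

Lemma dist_isom f x y : d (f x) (f y) = d x y.
Proof. by rewrite isomP. Qed.

Lemma dist_isomV f x y : d ((f^-1)%g x) y = d x (f y).
Proof. by rewrite -(dist_isom f) isomVK. Qed.

Lemma dist_isomVr f x y : d x ((f^-1)%g y) = d (f x) y.
Proof. by rewrite -(dist_isom f) isomVK. Qed.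

End MetricBasics.

(** * Points with prescribed distances *)

Section Extension.
Context {R : realType} {U : metricType R}.
Variable hU : is_bounded_urysohn U.
Implicit Types (x y z : U) (f g k : isom U).

Lemma dist_le1 x y : d x y <= 1.
Proof.
rewrite -lee_fin -(urysohn_diam hU).
by apply: ereal_sup_ubound; exists (x, y).
Qed.

(** Universality embeds the one-point extension of a finite subset, and
    homogeneity moves the copy of the subset back to where it came from. *)
Lemma katetov_realized (Z : seq U) (q : U -> R) :
    {in Z, forall x, 0 <= q x <= 1} ->
    {in Z &, forall x y, q x <= q y + d x y} ->
    {in Z &, forall x y, d x y <= q x + q y} ->
  exists c, {in Z, forall x, d c x = q x}.
Proof.
move=> q01 qlip qtri.
have [[z zZ /eqP qz0]|qneq0] := pselect (exists2 z, z \in Z & q z == 0).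
  exists z => x xZ; have := qtri _ _ zZ xZ; have := qlip _ _ xZ zZ.
  rewrite (metric_sym x); lra.
have {qneq0} qgt0 x : x \in Z -> 0 < q x.
  move=> xZ; have /andP[q0 _] := q01 _ xZ; rewrite lt_def q0 andbT.
  by apply/negP => qx0; apply: qneq0; exists x.
pose T := option (seq_sub Z).
pose dT (s t : T) : R := match s, t with
  | None, None => 0
  | Some x, None | None, Some x => q (val x)
  | Some x, Some y => d (val x) (val y) end.
have dTxx s : dT s s = 0 by case: s => //= s; rewrite mdistxx.
have dT_eq s t : dT s t = 0 -> s = t.
  case: s t => [[x xZ]|] [[y yZ]|] //=.
  - by move/mdist_positivity => xy; congr Some; apply/val_inj.
  - by move=> q0; have := qgt0 _ xZ; rewrite q0 ltxx.
  - by move=> q0; have := qgt0 _ yZ; rewrite q0 ltxx.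
have dTC s t : dT s t = dT t s.
  by case: s t => [s|] [t|] //=; rewrite metric_sym.
have dT_tri s t u : dT t u <= dT t s + dT s u.
  case: s t u => [[x xZ]|] [[y yZ]|] [[z zZ]|] //=.
  - exact: metric_triangle.
  - by rewrite addrC qlip.
  - by rewrite metric_sym qlip.
  - by rewrite addr_ge0// ltW// qgt0.
  - exact: qtri.
  - by rewrite addr0.
  - by rewrite add0r.
pose mT := isMetric.Build R T dTxx dT_eq dTC dT_tri.
pose S : metricType R := HB.pack T mT.
have dSE (s t : S) : mdist s t = dT s t by [].
have Sfin : finite_set [set: S].
  suff -> : [set: S] = [set` enum {: option (seq_sub Z)}] by exact: finite_seq.
  by apply/seteqP; split => // s _ /=; rewrite mem_enum.
have Sdiam : (diam S <= 1)%E.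
  apply: ge_ereal_sup => _ [[s t] _ <-]; rewrite lee_fin dSE.
  case: s t => [[x xZ]|] [[y yZ]|] //=; first exact: dist_le1.
  - by have /andP[] := q01 _ xZ.
  - by have /andP[] := q01 _ yZ.
have [j jP] := urysohn_universal hU Sfin Sdiam.
pose back x := if insub x is Some s then j (Some s) else x.
have [|g gP] := @urysohn_homogeneous _ _ hU [set` Z] back (finite_seq Z).
  move=> x y xZ yZ; rewrite /back (insubT (mem Z) xZ) (insubT (mem Z) yZ).
  by rewrite jP.
exists ((g^-1)%g (j None)) => x xZ.
rewrite dist_isomV gP// /back (insubT (mem Z) xZ) jP//.
Qed.

Lemma foldr_minP (s : seq R) :
  [/\ foldr Num.min 1 s <= 1, {in s, forall r, foldr Num.min 1 s <= r} &
      foldr Num.min 1 s = 1 \/ foldr Num.min 1 s \in s].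
Proof.
elim: s => [|r s [IH1 IHr IHs]] /=; first by split => //; left.
split; first by rewrite ge_min IH1 orbT.
  move=> t; rewrite inE ge_min => /orP[/eqP->|/IHr->]; first by rewrite lexx.
  by rewrite orbT.
case: leP => _; first by right; rewrite inE eqxx.
by case: IHs => [|sm]; [left|right; rewrite inE sm orbT].
Qed.

(** The largest 1-Lipschitz function below 1 and below the given bounds is a
    Katetov function, because any two bounds satisfy the triangle inequality. *)
Lemma free_point (L : seq (U * R)) (Z : seq U) :
    {in L &, forall p p', d p.1 p'.1 <= p.2 + p'.2} ->
  exists c, {in L, forall p, d c p.1 <= p.2} /\
    {in Z, forall z, 1 <= d c z \/ exists2 p, p \in L & p.2 + d p.1 z <= d c z}.
Proof.
move=> Ltri; pose q z := foldr Num.min 1 [seq p.2 + d p.1 z | p <- L].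
have q1 z : q z <= 1 by have [] := foldr_minP [seq p.2 + d p.1 z | p <- L].
have qle z p : p \in L -> q z <= p.2 + d p.1 z.
  move=> pL; have [_ + _] := foldr_minP [seq p.2 + d p.1 z | p <- L]; apply.
  exact: map_f.
have qP z : q z = 1 \/ exists2 p, p \in L & q z = p.2 + d p.1 z.
  rewrite /q; have [_ _ [->|/mapP[p pL ->]]] :=
    foldr_minP [seq p.2 + d p.1 z | p <- L]; first by left.
  by right; exists p.
have L0 p : p \in L -> 0 <= p.2.
  by move=> pL; have := Ltri _ _ pL pL; rewrite mdistxx; lra.
have qlip x y : q x <= q y + d x y.
  have [->|[p pL ->]] := qP y; first by have := mdist_ge0 x y; have := q1 x; lra.
  have := qle x _ pL; have := metric_triangle p.1 y x.
  by rewrite (metric_sym y x); lra.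
have qtri x y : d x y <= q x + q y.
  have q0 z : 0 <= q z.
    have [->|[p pL ->]] := qP z; first by [].
    by rewrite addr_ge0 ?L0 ?mdist_ge0.
  have [->|[p pL ->]] := qP x; first by have := q0 y; have := dist_le1 x y; lra.
  have [->|[p' p'L ->]] := qP y.
    by have := L0 _ pL; have := mdist_ge0 p.1 x; have := dist_le1 x y; lra.
  have := Ltri _ _ pL p'L; have := metric_triangle x p.1 y.
  by have := metric_triangle p.1 p'.1 y; rewrite (metric_sym x p.1); lra.
have [z _|x y _ _|x y _ _|c cP] :=
  @katetov_realized (Z ++ [seq p.1 | p <- L]) q.
- rewrite q1 andbT; have := qtri z z; rewrite mdistxx; lra.
- exact: qlip.
- exact: qtri.
exists c; split=> [p pL|z zZ].
  rewrite cP ?mem_cat ?map_f ?orbT// (le_trans (qle _ _ pL))//.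
  by rewrite mdistxx addr0.
rewrite cP ?mem_cat ?zZ//; have [->|[p pL ->]] := qP z; first by left.
by right; exists p.
Qed.

(** Homogeneity, one point at a time. *)
Lemma isom_extend (P : seq U) k x y :
    {in P, forall z, d y (k z) = d x z} ->
  exists k', {in P, k' =1 k} /\ k' x = y.
Proof.
move=> yP; pose f z := if z == x then y else k z.
have [|g gP] := @urysohn_homogeneous _ _ hU [set` x :: P] f (finite_seq _).
  move=> s t /=; rewrite !inE /f.
  have [->|_] := eqVneq s x; have [->|_] := eqVneq t x => /=.
  - by rewrite !mdistxx.
  - by move=> _ tP; exact: yP.
  - by move=> sP _; rewrite metric_sym [RHS]metric_sym; exact: yP.
  - by move=> _ _; exact: dist_isom.
exists g; split=> [z zP|].
  rewrite gP /= ?inE ?zP ?orbT// /f; have [zx|//] := eqVneq z x.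
  by apply: mdist_positivity; rewrite yP// zx mdistxx.
by rewrite gP /= ?inE ?eqxx// /f eqxx.
Qed.

End Extension.

(** * Independence over a finite set *)

Section Independence.
Context {R : realType} {U : metricType R}.
Implicit Types (x y z : U) (f g k : isom U) (C : seq U).

(** The distance of [a] and [b] is the largest one that their distances to [C]
    and the bound 1 permit: the two points are freely amalgamated over [C]. *)
Definition indep C a b :=
  1 <= d a b \/ exists2 c : U, c \in C & d a c + d c b <= d a b.

Lemma indepC C a b : indep C a b -> indep C b a.
Proof.
case=> [ab|[c cC cab]]; first by left; rewrite metric_sym.
by right; exists c => //; rewrite !(metric_sym b) (metric_sym c a) addrC.
Qed.

Lemma indepS C C' a b : {subset C <= C'} -> indep C a b -> indep C' a b.
Proof. by move=> CC' [ab|[c /CC' cC cab]]; [left|right; exists c]. Qed.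

Lemma indep_mem C a b : b \in C -> indep C a b.
Proof. by move=> bC; right; exists b => //; rewrite mdistxx addr0. Qed.

Lemma indep_trans D C a b :
  indep D a b -> {in D, forall x, indep C a x} -> indep C a b.
Proof.
case=> [ab _|[x xD xab] /(_ _ xD)[ax|[c cC cax]]]; first by left.
  by left; have := mdist_ge0 x b; lra.
by right; exists c => //; have := metric_triangle c x b; lra.
Qed.

Lemma indep_isom f C a b : indep [seq f x | x <- C] (f a) (f b) <-> indep C a b.
Proof.
split=> -[ab|]; try by left; move: ab; rewrite dist_isom.
  by move=> [_ /mapP[c cC ->]]; rewrite !dist_isom; right; exists c.
by move=> [c cC cab]; right; exists (f c); rewrite ?map_f// !dist_isom.
Qed.

Lemma indep_fixed f C a b : {in C, forall x, f x = x} ->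
  indep C (f a) (f b) <-> indep C a b.
Proof.
move=> fC; have := indep_isom f C a b.
by rewrite (_ : [seq f x | x <- C] = C)// (eq_in_map _ id C).1 ?map_id.
Qed.

End Independence.

Section FreeMove.
Context {R : realType} {U : metricType R}.
Variable hU : is_bounded_urysohn U.
Implicit Types (x y z : U) (f g k : isom U) (C : seq U).

(** Stationarity: both distances are the largest that the distances to [C]
    permit. *)
Lemma indep_unique C a a' b : {in C, forall x, d a x = d a' x} ->
  indep C a b -> indep C a' b -> d a b = d a' b.
Proof.
have le_ab c c' : {in C, forall x, d c x = d c' x} -> indep C c' b ->
    d c b <= d c' b.
  move=> cc' [/(le_trans (dist_le1 hU c b))//|[x xC]]; apply: le_trans.
  by rewrite -cc'// metric_triangle.
move=> aa' ab a'b; apply/eqP; rewrite eq_le !le_ab// => x xC.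
by rewrite aa'.
Qed.

(** The images of the points of [E] are chosen one after the other, each by
    [free_point] with the bounds coming from [C] and from the earlier images. *)
Lemma free_move C (E F : seq U) : exists k : isom U,
  {in C, forall x, k x = x} /\ {in E & F, forall x y, indep C (k x) y}.
Proof.
elim: E => [|e E [k [kC kE]]]; first by exists 1%g.
pose P := C ++ E.
have [|c [cL cF]] :=
    @free_point _ _ hU [seq (k x, d e x) | x <- P] (F ++ map k P).
  move=> _ _ /mapP[x _ ->] /mapP[y _ ->] /=.
  by rewrite dist_isom (metric_sym e x) metric_triangle.
have [|k' [k'P k'e]] := @isom_extend _ _ hU P k e c.
  move=> x xP; apply/eqP; rewrite eq_le; apply/andP; split.
    exact: (cL (k x, d e x) (map_f (fun x => (k x, d e x)) xP)).
  have [|/(le_trans (dist_le1 hU e x))//|[_ /mapP[y yP ->] /=]] := cF (k x).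
    by rewrite mem_cat map_f ?orbT.
  by apply: le_trans; rewrite dist_isom metric_triangle.
have k'C x : x \in C -> k' x = x.
  by move=> xC; rewrite k'P ?kC// mem_cat xC.
exists k'; split=> // x y; rewrite inE => /orP[/eqP->|xE] yF; last first.
  by rewrite k'P ?mem_cat ?xE ?orbT//; exact: kE.
rewrite k'e; have [|cy|[_ /mapP[z zP ->] /= zy]] := cF y.
- by rewrite mem_cat yF.
- by left.
have cz : d c (k z) <= d e z.
  exact: (cL (k z, d e z) (map_f (fun x => (k x, d e x)) zP)).
move: (zP); rewrite mem_cat => /orP[zC|zE].
  by right; exists z => //; rewrite kC// in cz zy; lra.
have [kzy|[x0 x0C x0y]] := kE _ _ zE yF.
  by left; have := mdist_ge0 e z; lra.
right; exists x0 => //; have := metric_triangle c (k z) x0; lra.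
Qed.

End FreeMove.

(** * Pointwise limits of isometries *)

Section Limits.
Context {R : realType} {U : metricType R}.
Variable hU : is_bounded_urysohn U.
Implicit Types (x y z : U) (f g k : isom U) (h : nat -> isom U).

Definition point_lim (u : nat -> U) (l : U) :=
  forall e : R, 0 < e -> exists N, forall n, (N <= n)%N -> d (u n) l <= e.

Definition isom_lim h g := forall x, point_lim (fun n => h n x) (g x).

Lemma point_lim_unique (u : nat -> U) l l' :
  point_lim u l -> point_lim u l' -> l = l'.
Proof.
move=> ul ul'; apply: mdist_positivity; apply/eqP.
rewrite eq_le mdist_ge0 andbT; apply/ler_addgt0Pl => e e0; rewrite addr0.
have e20 : 0 < e / 2 by rewrite divr_gt0.
have [N1 N1P] := ul _ e20; have [N2 N2P] := ul' _ e20.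
have := N1P _ (leq_maxl N1 N2); have := N2P _ (leq_maxr N1 N2).
set m := maxn _ _; rewrite (metric_sym (u m) l).
by have := metric_triangle l (u m) l'; lra.
Qed.

Lemma isom_lim_eventually h g x y N : isom_lim h g ->
  (forall n, (N <= n)%N -> h n x = y) -> g x = y.
Proof.
move=> /(_ x) hg hy; apply: point_lim_unique hg _ => e e0.
by exists N => n /hy ->; rewrite mdistxx ltW.
Qed.

Lemma isom_lim_cst g : isom_lim (fun=> g) g.
Proof. by move=> x e e0; exists 0%N => n _; rewrite mdistxx ltW. Qed.

Lemma isom_limM h h' g g' : isom_lim h g -> isom_lim h' g' ->
  isom_lim (fun n => h n * h' n)%g (g * g')%g.
Proof.
move=> hg hg' x e e0; have e20 : 0 < e / 2 by rewrite divr_gt0.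
have [N1 N1P] := hg (g' x) _ e20; have [N2 N2P] := hg' x _ e20.
exists (maxn N1 N2) => n; rewrite geq_max => /andP[/N1P le1 /N2P].
rewrite -(dist_isom (h n)) !isomM => le2.
by have := metric_triangle (h n (h' n x)) (h n (g' x)) (g (g' x)); lra.
Qed.

Lemma isom_limV h g : isom_lim h g -> isom_lim (fun n => (h n)^-1)%g (g^-1)%g.
Proof.
move=> hg x e e0; have [N NP] := hg ((g^-1)%g x) _ e0.
by exists N => n /NP; rewrite isomVK dist_isomV metric_sym.
Qed.

Lemma complete_lim (u : nat -> U) :
    (forall e : R, 0 < e -> exists N, forall n, (N <= n)%N -> d (u n) (u N) <= e) ->
  exists l, point_lim u l.
Proof.
move=> u_cauchy.
have [|l ul] := @urysohn_complete _ _ hU (u @ \oo) _.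
  apply: cauchy_exP => e e0; have e20 : 0 < e / 2 by rewrite divr_gt0.
  have [N NP] := u_cauchy _ e20; exists (u N), N => // n /= Nn.
  by rewrite ballEmdist /= metric_sym (le_lt_trans (NP _ Nn))//; lra.
exists l => e e0; have /metricType_numDomainType.cvgrPdist_lt := ul.
by move=> /(_ _ e0)[N _ NP]; exists N => n /NP /ltW; rewrite metric_sym.
Qed.

Lemma dense_sequence :
  exists s : nat -> U, forall x (e : R), 0 < e -> exists n, d x (s n) <= e.
Proof.
have [D [/countable_injP[f f_inj] D_dense]] := urysohn_separable hU.
have near_D x (e : R) : 0 < e -> exists2 y, D y & d x y <= e.
  move=> e0; have [||y [yx Dy]] := D_dense (interior (ball x e)).
  - by exists x; apply: nbhsx_ballx.
  - exact: open_interior.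
  - exists y => //; have := interior_subset yx.
    by rewrite ballEmdist /= => /ltW.
have [x0 _] : exists x0 : U, True.
  by have [x0 _] := @free_point _ _ hU [::] [::] (fun _ _ => ltac:(by [])); exists x0.
exists (fun n => xget x0 [set y | D y /\ f y = n]) => x e /(near_D x)[y Dy xy].
exists (f y); case: xgetP => [z _ [Dz fzy]|/(_ y)[]//].
by rewrite (_ : z = y)//; apply: f_inj => //; exact: mem_set.
Qed.

(** On the dense sequence the isometries, and their inverses, are eventually
    constant; the last two assumptions make the limit total and onto. *)
Lemma isom_limit h (A : nat -> seq U) (s : nat -> U) :
    (forall x (e : R), 0 < e -> exists n, d x (s n) <= e) ->
    (forall n, {subset A n <= A n.+1}) ->
    (forall n, {in A n, h n.+1 =1 h n}) ->
    (forall n, s n \in A n.+1) ->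
    (forall n, ((h n.+1)^-1)%g (s n) \in A n.+1) ->
  exists g, isom_lim h g.
Proof.
move=> s_dense A_incr hA sA hsA.
have subA m n : (n <= m)%N -> {subset A n <= A m}.
  move=> /subnK <-; elim: (m - n)%N => // k IH x /IH; exact: A_incr.
have h_const m n x : (n <= m)%N -> x \in A n -> h m x = h n x.
  move=> /subnK <-; elim: (m - n)%N => // k IH xA.
  by rewrite -IH// addSn hA// (subA _ n)// leq_addl.
have lim (f : nat -> isom U) x :
    (forall i m, (i.+1 <= m)%N -> f m (s i) = f i.+1 (s i)) ->
    exists l, point_lim (fun n => f n x) l.
  move=> f_const; apply: complete_lim => e e0.
  have [|i xi] := s_dense x (e / 2); first by rewrite divr_gt0.
  exists i.+1 => n i_n.
  have := metric_triangle (f n x) (f n (s i)) (f i.+1 x).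
  rewrite dist_isom f_const// dist_isom (metric_sym (s i)).
  lra.
have /choice[g gP] x : exists l, point_lim (fun n => h n x) l.
  by apply: lim => i m im; exact: h_const.
have /choice[g' g'P] x : exists l, point_lim (fun n => ((h n)^-1)%g x) l.
  apply: (lim (fun n => (h n)^-1)%g) => i m im.
  by apply: (@isom_inj _ _ (h m)); rewrite isomVK (h_const _ _ _ im)// isomVK.
have g_isom : isometric_on setT g.
  move=> x y _ _; apply: subr0_eq; apply/eqP; rewrite -normr_eq0 eq_le normr_ge0.
  rewrite andbT; apply/ler_addgt0Pl => e e0; rewrite addr0.
  have e20 : 0 < e / 2 by rewrite divr_gt0.
  have [N1 N1P] := gP x _ e20; have [N2 N2P] := gP y _ e20.
  have := N1P _ (leq_maxl N1 N2); have := N2P _ (leq_maxr N1 N2).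
  set m := maxn _ _ => ym xm; rewrite -(dist_isom (h m) x y).
  have := metric_triangle (g x) (h m x) (g y).
  have := metric_triangle (h m x) (h m y) (g y).
  have := metric_triangle (h m x) (g x) (h m y).
  have := metric_triangle (g x) (g y) (h m y).
  rewrite (metric_sym (g x) (h m x)) (metric_sym (g y) (h m y)) ler_norml.
  by lra.
have g_surj y : exists x, g x = y.
  exists (g' y); apply: (@point_lim_unique (fun n => h n (g' y))); first exact: gP.
  move=> e e0; have [N NP] := g'P y _ e0; exists N => n /NP.
  by rewrite dist_isomV metric_sym.
by exists (Isom g_isom g_surj) => x; exact: gP.
Qed.

Lemma exists_sequence (T : Type) (Q : nat -> T -> T -> Prop) (t : T) :
    (forall n s, exists s', Q n s s') ->
  exists f : nat -> T, f 0%N = t /\ forall n, Q n (f n) (f n.+1).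
Proof.
move=> Qex; have /choice[next nextP] (p : nat * T) : exists t', Q p.1 p.2 t'.
  exact: Qex.
pose f := fix f n := if n is n'.+1 then next (n', f n') else t.
by exists f; split=> // n; exact: (nextP (n, f n)).
Qed.

(** A displacement bound on a finite set is inherited by some extension: adjoin
    one point [x] at a time, its image being the freest point that is within [r]
    of [x]. *)
Lemma small_isom (r : R) (A : seq U) k : 0 <= r ->
    {in A, forall x, d x (k x) <= r} ->
  exists g, {in A, g =1 k} /\ forall x, d x (g x) <= r.
Proof.
move=> r0 kA; have [s s_dense] := dense_sequence.
pose small (B : seq U) f := {in B, forall x, d x (f x) <= r}.
have extend (B : seq U) f x : small B f ->
    exists f', {in B, f' =1 f} /\ d x (f' x) <= r.
  move=> fB.
  have [|y [yL yZ]] := @free_point _ _ hU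
      ((x, r) :: [seq (f z, d x z) | z <- B]) [seq f z | z <- B].
    move=> p q; rewrite !inE => /orP[/eqP->|/mapP[z zB ->]] /=.
      move=> /orP[/eqP->|/mapP[z zB ->]] /=; first by rewrite mdistxx addr_ge0.
      by have := metric_triangle x z (f z); have := fB _ zB; lra.
    move=> /orP[/eqP->|/mapP[w wB ->]] /=.
      have := metric_triangle x z (f z); have := fB _ zB.
      by rewrite (metric_sym (f z)); lra.
    by rewrite dist_isom (metric_sym x z) metric_triangle.
  have [|f' [f'B f'x]] := @isom_extend _ _ hU B f x y; last first.
    exists f'; split=> //; rewrite f'x metric_sym.
    by apply: (yL (x, r)); rewrite inE eqxx.
  move=> z zB; apply/eqP; rewrite eq_le; apply/andP; split.
    by apply: (yL (f z, d x z)); rewrite inE (map_f (fun z => (f z, d x z)))// orbT.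
  have [|/(le_trans (dist_le1 hU x z))//|[p + pz]] := yZ (f z); first exact: map_f.
  rewrite inE => /orP[/eqP pE|/mapP[w wB pE]]; move: pz; rewrite {}pE /=.
    have := metric_triangle x (f z) z; have := fB _ zB.
    by rewrite (metric_sym z); lra.
  by rewrite dist_isom; apply: le_trans; exact: metric_triangle.
pose T := {p : seq U * isom U | small p.1 p.2}.
pose Q n (t t' : T) := let: (B, f) := sval t in let: (B', f') := sval t' in
  [/\ {subset B <= B'}, {in B, f' =1 f}, s n \in B' & (f'^-1)%g (s n) \in B'].
have Qex n t : exists t', Q n t t'.
  case: t => [[B f] /= fB]; have [f1 [f1B f1s]] := extend B f (s n) fB.
  pose B1 := s n :: B.
  have f1B1 : small B1 f1.
    by move=> x; rewrite inE => /orP[/eqP->//|xB]; rewrite f1B ?fB.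
  (* Reaching [s n] from the other side: extend the inverse instead. *)
  have [|f2 [f2B f2s]] := extend [seq f1 x | x <- B1] (f1^-1)%g (s n).
    by move=> _ /mapP[x xB ->]; rewrite isomK metric_sym f1B1.
  have f2E x : x \in B1 -> (f2^-1)%g x = f1 x.
    by move=> xB; rewrite -{1}(isomK f1 x) -f2B ?map_f// isomK.
  have f2P : small (f2 (s n) :: B1) (f2^-1)%g.
    move=> x; rewrite inE => /orP[/eqP->|xB]; first by rewrite isomK metric_sym.
    by rewrite f2E ?f1B1.
  exists (exist _ (f2 (s n) :: B1, (f2^-1)%g) f2P); split.
  - by move=> x xB; rewrite !inE xB !orbT.
  - by move=> x xB; rewrite f2E ?inE ?xB ?orbT// f1B.
  - by rewrite !inE eqxx orbT.
  - by rewrite invgK inE eqxx.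
have [F [F0 FQ]] := exists_sequence (exist _ (A, k) kA : T) Qex.
pose B n := (sval (F n)).1; pose h n := (sval (F n)).2.
have {}FQ n : [/\ {subset B n <= B n.+1}, {in B n, h n.+1 =1 h n},
    s n \in B n.+1 & ((h n.+1)^-1)%g (s n) \in B n.+1].
  by have := FQ n; rewrite /Q /B /h; case: (sval (F n)) => ? ?; case: (sval _).
have [||||g gP] := @isom_limit h B s s_dense; try by move=> n; have [] := FQ n.
have hB n m x : x \in B n -> x \in B (m + n)%N /\ h (m + n)%N x = h n x.
  move=> xB; elim: m => // m [xBm hx]; have [sB hB _ _] := FQ (m + n)%N.
  by rewrite addSn; split; [exact: sB|rewrite hB].
have gB n x : x \in B n -> g x = h n x.
  move=> xB; apply: (@isom_lim_eventually h _ _ _ n) gP _ => m /subnK <-.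
  by have [] := hB n (m - n)%N _ xB.
exists g; split=> [x xA|x].
  by rewrite (gB 0%N) /h /B F0.
apply/ler_addgt0Pl => e e0; have e20 : 0 < e / 2 by rewrite divr_gt0.
have [n xn] := s_dense x _ e20; have [_ _ sB _] := FQ n.
have := svalP (F n.+1) _ sB; rewrite -/(h n.+1) -(gB _ _ sB).
have := metric_triangle x (s n) (g x); have := metric_triangle (s n) (g (s n)) (g x).
by rewrite dist_isom (metric_sym (s n) x); lra.
Qed.

Lemma isom_eq_dense (s : nat -> U) f g :
    (forall x (e : R), 0 < e -> exists n, d x (s n) <= e) ->
    (forall n, f (s n) = g (s n)) -> f = g.
Proof.
move=> s_dense fg; apply: isom_ext => x; apply: mdist_positivity; apply/eqP.
rewrite eq_le mdist_ge0 andbT; apply/ler_addgt0Pl => e e0; rewrite addr0.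
have [|n xn] := s_dense x (e / 2); first by rewrite divr_gt0.
have := metric_triangle (f x) (f (s n)) (g x).
by rewrite dist_isom fg dist_isom (metric_sym (s n)); lra.
Qed.

End Limits.

(** * An isometry of displacement exactly one half *)

Section Displacement.
Context {R : realType} {U : metricType R}.
Variable hU : is_bounded_urysohn U.
Implicit Types (x y z : U) (f g k : isom U).

(** The case of [katetov_realized] where the distances are listed. *)
Lemma point_at (L : seq (U * R)) :
    {in L, forall p, 0 <= p.2 <= 1} ->
    {in L &, forall p p', p.2 <= p'.2 + d p.1 p'.1 /\ d p.1 p'.1 <= p.2 + p'.2} ->
  exists c, {in L, forall p, d c p.1 = p.2}.
Proof.
move=> L01 LK; have [|c [cL cZ]] := @free_point _ _ hU L [seq p.1 | p <- L].
  by move=> p p' pL p'L; have [] := LK _ _ pL p'L.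
exists c => p pL; apply/eqP; rewrite eq_le cL//=.
have [|/(le_trans _)->//|[p' p'L]] := cZ p.1; first exact: map_f.
  by have /andP[] := L01 _ pL.
by apply: le_trans; rewrite metric_sym; have [] := LK _ _ pL p'L; rewrite metric_sym.
Qed.

Section NormalSubgroup.
Variable N : set (isom U).
Variable N_normal : normal_subgroup N.

Let orbit x y := exists2 n, N n & n x = y.

(** With every distance [r], the orbit relation contains all distances up to
    [2 * r]: join two points by a point at distance [r], or by a midpoint. *)
Lemma normal_transitive g x y : N g -> g <> 1%g -> exists2 n, N n & n x = y.
Proof.
have [[N1 NM NV] NJ] := N_normal; move=> Ng g_neq1.
have [a ga] : exists a, g a != a.
  apply: contrapT => /forallNP g_fix; apply: g_neq1; apply: isom_ext => a /=.
  by have /negP := g_fix a; rewrite negbK => /eqP.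
have e0 : 0 < d a (g a) by rewrite mdist_gt0 eq_sym.
set e := d a (g a) in e0.
have orbit_trans u v w : orbit u v -> orbit v w -> orbit u w.
  by move=> [m Nm <-] [n Nn <-]; exists (n * m)%g => //; exact: NM.
have orbit_sym u v : orbit u v -> orbit v u.
  by move=> [m Nm <-]; exists (m^-1)%g; [exact: NV|rewrite isomK].
have orbit_e u v : d u v = e -> orbit u v.
  move=> uv; have [|k [_ ka]] := @isom_extend _ _ hU [::] 1%g a u; first by [].
  have [|l [lP lga]] := @isom_extend _ _ hU [:: a] k (g a) v.
    by move=> z; rewrite inE => /eqP->; rewrite ka metric_sym uv metric_sym.
  exists (g ^ l^-1)%g; first exact: NJ.
  by rewrite isomJ invgK -lga -ka -(lP a) ?inE// isomK.
have orbit_double (r : R) : (forall u v, d u v <= r -> orbit u v) ->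
    forall u v, d u v <= r + r -> orbit u v.
  move=> orb u v uv; have uv0 := mdist_ge0 u v; have uv1 := dist_le1 hU u v.
  have [||c cP] := @point_at [:: (u, d u v / 2); (v, d u v / 2)].
  - by move=> p; rewrite !inE => /orP[]/eqP-> /=; lra.
  - by move=> p p'; rewrite !inE => /orP[]/eqP-> /orP[]/eqP-> /=;
       rewrite ?mdistxx ?(metric_sym v u); lra.
  have := cP (u, d u v / 2); have := cP (v, d u v / 2); rewrite !inE !eqxx orbT /=.
  move=> /(_ isT) cv /(_ isT) cu; apply: (orbit_trans _ c); apply: orb.
    by rewrite metric_sym cu; lra.
  by rewrite cv; lra.
have orbit_le n u v : d u v <= e * 2 ^+ n -> orbit u v.
  elim: n u v => [|n IH] u v.
    rewrite expr0 mulr1 => uv; have uv0 := mdist_ge0 u v.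
    have e1 : e <= 1 by exact: dist_le1.
    have [||c cP] := @point_at [:: (u, e); (v, e)].
    - by move=> p; rewrite !inE => /orP[]/eqP-> /=; lra.
    - by move=> p p'; rewrite !inE => /orP[]/eqP-> /orP[]/eqP-> /=;
         rewrite ?mdistxx ?(metric_sym v u); lra.
    apply: (orbit_trans _ c); [apply: orbit_sym|]; apply: orbit_e.
      by have := cP (u, e); rewrite !inE eqxx => /(_ isT).
    by have := cP (v, e); rewrite !inE eqxx orbT => /(_ isT).
  by rewrite exprS mulrCA mulr_natl mulr2n; apply: orbit_double.
have [n n_big] : exists n, 1 <= e * 2 ^+ n.
  pose m := Num.truncn e^-1.
  exists m.+1; rewrite -ler_pdivrMl// mulr1.
  apply: (@le_trans _ _ m.+1%:R); first exact/ltW/Num.Theory.truncnS_gt.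
  by rewrite -natrX ler_nat ltnW// ltn_expl.
exact/(orbit_le n)/(le_trans (dist_le1 hU x y)).
Qed.

(** A commutator [g, k] moves points at most twice as far as [k]. Taking [k] of
    displacement at most 1/4, the two moves by [k] can be made to add up at one
    point because [g] moves some point by 1. *)
Lemma normal_half_isom : N <> [set 1%g] ->
  exists g, [/\ N g, forall x, d x (g x) <= 1 / 2 & exists a, d a (g a) = 1 / 2].
Proof.
move=> N_neq1; have [[N1 NM NV] NJ] := N_normal.
have [g0 [Ng0 g0_neq1]] : exists g, N g /\ g <> 1%g.
  apply: contrapT => /forallNP triv; apply: N_neq1; apply/seteqP; split => [g Ng|_ ->//].
  by apply: contrapT => g1; exact: (triv g).
have [a _] := @free_point _ _ hU [::] [::] (fun _ _ => ltac:(by [])).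
have [a' [_ a'1]] := @free_point _ _ hU [::] [:: a] (fun _ _ => ltac:(by [])).
have {a'1} aa' : d a' a = 1.
  have [|far|[]//] := a'1 a; first by rewrite inE.
  by apply/eqP; rewrite eq_le far dist_le1.
have [g Ng ga] := normal_transitive a a' Ng0 g0_neq1.
have {a' ga aa'} ga : d (g a) a = 1 by rewrite ga.
have [|b [ba bZ]] := @free_point _ _ hU [:: (a, 1 / 4)] [:: a; g a; (g^-1)%g a].
  by move=> p p'; rewrite !inE => /eqP-> /eqP->; rewrite /= mdistxx; lra.
have {}ba : d b a <= 1 / 4 by apply: (ba (a, 1 / 4)); rewrite inE.
have b_free z : z \in [:: a; g a; (g^-1)%g a] -> 1 <= d b z \/ 1 / 4 + d a z <= d b z.
  by move=> /bZ[|[p]]; [left|rewrite inE => /eqP->; right].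
have {}ba : d b a = 1 / 4.
  by have [|?|] := b_free a; rewrite ?inE ?eqxx ?mdistxx//; lra.
have bga : d b (g a) = 1.
  by have [|?|] := b_free (g a); have := dist_le1 hU b (g a);
     rewrite ?inE ?eqxx ?orbT// 1?(metric_sym a) ?ga; lra.
have gba : d (g b) a = 1.
  rewrite -dist_isomVr.
  by have [|?|] := b_free ((g^-1)%g a); have := dist_le1 hU b ((g^-1)%g a);
     rewrite ?inE ?eqxx ?orbT// ?(dist_isomVr g a) ?ga; lra.
have gbga : d (g b) (g a) = 1 / 4 by rewrite dist_isom.
have bgb : 3 / 4 <= d b (g b) <= 1.
  by rewrite dist_le1// andbT; have := metric_triangle b (g b) (g a); lra.
(* [e] will be the point that [k] sends to [g b]. *)
have [||e eP] := @point_at [:: (g b, 1 / 4); (g a, 1 / 2); (a, d b (g b))].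
- by move=> p; rewrite !inE => /or3P[]/eqP-> /=; lra.
- by move=> p p'; rewrite !inE => /or3P[]/eqP-> /or3P[]/eqP-> /=;
     rewrite ?mdistxx ?(metric_sym (g a) (g b)) ?(metric_sym a) ?ga ?gba ?gbga; lra.
have egb : d e (g b) = 1 / 4 by apply: (eP (g b, 1 / 4)); rewrite inE eqxx.
have ega : d e (g a) = 1 / 2 by apply: (eP (g a, 1 / 2)); rewrite !inE eqxx orbT.
have ea : d e a = d b (g b) by apply: (eP (a, d b (g b))); rewrite !inE eqxx !orbT.
have [|k0 [_ k0a]] := @isom_extend _ _ hU [::] 1%g a b; first by [].
have [|k1 [k1P k1e]] := @isom_extend _ _ hU [:: a] k0 e (g b).
  by move=> z; rewrite inE => /eqP->; rewrite k0a ea metric_sym.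
have k1a : k1 a = b by rewrite k1P ?inE.
have [||k [kP k_small]] := @small_isom _ _ hU (1 / 4) [:: a; e] k1; first by lra.
  move=> z; rewrite !inE => /orP[]/eqP->; rewrite ?k1a ?k1e ?egb//.
  by rewrite metric_sym ba.
have ka : k a = b by rewrite kP ?inE ?eqxx.
have ke : k e = g b by rewrite kP ?inE ?eqxx ?orbT.
have gkE x : d x ((g^-1 * g ^ k)%g x) = d (k (g x)) (g (k x)).
  by rewrite isomM dist_isomVr isomJ dist_isomVr.
exists (g^-1 * g ^ k)%g; split=> [|x|]; first by apply: NM; [exact: NV|exact: NJ].
  rewrite gkE; have := metric_triangle (k (g x)) (g x) (g (k x)).
  rewrite dist_isom (metric_sym (k (g x)) (g x)).
  by have := k_small x; have := k_small (g x); lra.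
by exists a; rewrite gkE ka -ke dist_isom metric_sym.
Qed.

End NormalSubgroup.

End Displacement.

(** * Moving a point as far as possible *)

Section FreeImage.
Context {R : realType} {U : metricType R}.
Variable hU : is_bounded_urysohn U.
Implicit Types (x y z : U) (f g k : isom U).

Definition half_isom g :=
  (forall x, d x (g x) <= 1 / 2) /\ exists a, d a (g a) = 1 / 2.

Lemma half_isomJ g k : half_isom g -> half_isom (g ^ k)%g.
Proof.
move=> [g_half [a ga]]; split=> [x|]; first by rewrite isomJ dist_isomVr.
by exists ((k^-1)%g a); rewrite isomJ dist_isom isomVK.
Qed.

(** Every type over a finite set [Y] has a realization [c] whose image is as far
    from it as the bound 1/2 and the forced inequalities
    [d c (g c) <= d a y + d y (g y') + d y' a] allow.
    A single point [a0] moved by 1/2 suffices: [a1] at distance 1/2 from [a0] is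
    again moved by 1/2 but is far from [Y]; then so is [b], at distance 1/2 from
    [a1], which behaves towards [Y] like a point at distance 1/2 from the type;
    finally [c] is put at distance 1/2 from [b] and as far as possible from
    [g b]. *)
Lemma free_image g (Y : seq U) a : half_isom g ->
  exists c, [/\ {in Y, forall y, d c y = d a y},
    {in Y, forall y, indep Y c (g y)}, {in Y, forall y, indep Y c ((g^-1)%g y)} &
    1 / 2 <= d c (g c) \/ exists y y', [/\ y \in Y, y' \in Y &
      d a y + d y (g y') + d y' a <= d c (g c)]].
Proof.
move=> [_ [a0 ga0]].
have [|a1 [a1L a1Z]] := @free_point _ _ hU [:: (a0, 1 / 2)]
    (g a0 :: [seq (g^-1)%g y | y <- Y]).
  by move=> p p'; rewrite !inE => /eqP-> /eqP->; rewrite /= mdistxx; lra.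
have {}a1L : d a1 a0 <= 1 / 2 by apply: (a1L (a0, 1 / 2)); rewrite inE.
have {}a1Z z : z \in g a0 :: [seq (g^-1)%g y | y <- Y] ->
    1 <= d a1 z \/ 1 / 2 + d a0 z <= d a1 z.
  by move=> /a1Z[|[p]]; [left|rewrite inE => /eqP->; right].
have a1far y : y \in Y -> 1 / 2 <= d a1 ((g^-1)%g y).
  move=> yY; have := mdist_ge0 a0 ((g^-1)%g y).
  by have [|?|] := a1Z ((g^-1)%g y); rewrite ?inE ?map_f ?orbT//; lra.
have ga0_a1 : 1 <= d a1 (g a0).
  by have [|//|] := a1Z (g a0); rewrite ?inE ?eqxx// ga0; lra.
have ga1 : 1 / 2 <= d a1 (g a1).
  have := metric_triangle a1 (g a1) (g a0); rewrite dist_isom; lra.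
pose Lb := (a1, 1 / 2) :: [seq (y, 1 / 2 + d a y) | y <- Y].
have [|b [bL bZ]] := @free_point _ _ hU Lb
    (g a1 :: Y ++ [seq g y | y <- Y] ++ [seq (g^-1)%g y | y <- Y]).
  move=> p p'; rewrite !inE => /orP[/eqP->|/mapP[y _ ->]];
    move=> /orP[/eqP->|/mapP[y' _ ->]] /=.
  - by rewrite mdistxx; lra.
  - by have := dist_le1 hU a1 y'; have := mdist_ge0 a y'; lra.
  - by have := dist_le1 hU y a1; have := mdist_ge0 a y; lra.
  - by have := metric_triangle y a y'; rewrite (metric_sym y a); lra.
have ba1 : d b a1 <= 1 / 2 by apply: (bL (a1, 1 / 2)); rewrite inE eqxx.
have bY y : y \in Y -> d b y <= 1 / 2 + d a y.
  move=> yY; apply: (bL (y, 1 / 2 + d a y)).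
  by rewrite inE (map_f (fun y => (y, 1 / 2 + d a y)))// orbT.
have {bL}bZ z : z \in g a1 :: Y ++ [seq g y | y <- Y] ++ [seq (g^-1)%g y | y <- Y] ->
    [\/ 1 <= d b z, 1 / 2 + d a1 z <= d b z |
        exists2 y, y \in Y & 1 / 2 + d a y + d y z <= d b z].
  move=> /bZ[|[p]]; first by constructor 1.
  rewrite inE => /orP[/eqP->|/mapP[y yY ->]] /= ?; first by constructor 2.
  by constructor 3; exists y.
have b_half z : z \in g a1 :: Y ++ [seq g y | y <- Y] ++ [seq (g^-1)%g y | y <- Y] ->
    1 / 2 <= d b z.
  move=> /bZ[||[y _]]; first lra; first by have := mdist_ge0 a1 z; lra.
  by have := mdist_ge0 a y; have := mdist_ge0 y z; lra.
have b_ga1 : 1 <= d b (g a1).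
  have [|//||[y yY]] := bZ (g a1); first by rewrite inE eqxx.
    by lra.
  by have := a1far _ yY; rewrite dist_isomVr metric_sym; have := mdist_ge0 a y; lra.
have gb : 1 / 2 <= d b (g b).
  by have := metric_triangle b (g b) (g a1); rewrite dist_isom; lra.
have gbY y : y \in Y -> 1 <= d y (g b) \/
    exists2 y', y' \in Y & 1 / 2 + d a y' + d y (g y') <= d y (g b).
  move=> yY; have a1y := a1far _ yY; rewrite (metric_sym y) -dist_isomVr.
  have [|?|?|[y' y'Y ?]] := bZ ((g^-1)%g y).
  - by rewrite !inE !mem_cat map_f ?orbT.
  - by left.
  - by left; lra.
  - by right; exists y'; rewrite // (metric_sym y) -dist_isomVr.
pose Lc := (b, 1 / 2) :: [seq (y, d a y) | y <- Y].
have [|c [cL cZ]] := @free_point _ _ hU Lc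
    (g b :: Y ++ [seq g y | y <- Y] ++ [seq (g^-1)%g y | y <- Y]).
  move=> p p'; rewrite !inE => /orP[/eqP->|/mapP[y yY ->]];
    move=> /orP[/eqP->|/mapP[y' y'Y ->]] /=.
  - by rewrite mdistxx; lra.
  - exact: bY.
  - by rewrite metric_sym addrC; exact: bY.
  - by rewrite (metric_sym a) metric_triangle.
have cb : d c b <= 1 / 2 by apply: (cL (b, 1 / 2)); rewrite inE eqxx.
have cY y : y \in Y -> d c y <= d a y.
  move=> yY; apply: (cL (y, d a y)).
  by rewrite inE (map_f (fun y => (y, d a y)))// orbT.
have {cL}cZ z : z \in g b :: Y ++ [seq g y | y <- Y] ++ [seq (g^-1)%g y | y <- Y] ->
    [\/ 1 <= d c z, 1 / 2 + d b z <= d c z |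
        exists2 y, y \in Y & d a y + d y z <= d c z].
  move=> /cZ[|[p]]; first by constructor 1.
  rewrite inE => /orP[/eqP->|/mapP[y yY ->]] /= ?; first by constructor 2.
  by constructor 3; exists y.
have c_indep z : z \in Y ++ [seq g y | y <- Y] ++ [seq (g^-1)%g y | y <- Y] ->
    1 <= d c z \/ exists2 y, y \in Y & d a y + d y z <= d c z.
  move=> zZ; have [|?|?|?] := cZ z; first by rewrite inE zZ orbT.
  - by left.
  - by left; have := b_half z; rewrite inE zZ orbT => /(_ isT); lra.
  - by right.
have cYE y : y \in Y -> d c y = d a y.
  move=> yY; apply/eqP; rewrite eq_le cY//=.
  have [|/(le_trans (dist_le1 hU a y))//|[y' _]] := c_indep y.
    by rewrite mem_cat yY.
  by apply: le_trans; exact: metric_triangle.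
have c_indepY z : z \in Y ++ [seq g y | y <- Y] ++ [seq (g^-1)%g y | y <- Y] ->
    indep Y c z.
  by move=> /c_indep[cz|[y yY cz]]; [left|right; exists y; rewrite ?(cYE _ yY)].
exists c; split=> // [y yY|y yY|].
- by apply: c_indepY; rewrite !mem_cat (map_f g)// orbT.
- by apply: c_indepY; rewrite !mem_cat (map_f (g^-1)%g)// !orbT.
have c_gc := metric_triangle c (g c) (g b); rewrite dist_isom in c_gc.
have [||| [y yY cgb]] := cZ (g b); first by rewrite inE eqxx.
- by left; lra.
- by left; lra.
have [|[y' y'Y]] := gbY _ yY; first by left; have := mdist_ge0 a y; lra.
by right; exists y, y'; split=> //; rewrite (metric_sym y' a); lra.
Qed.

End FreeImage.

(** * Chains of conjugates in general position *)

Section GeneralPosition.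
Context {R : realType} {U : metricType R}.
Variable hU : is_bounded_urysohn U.
Implicit Types (x y z : U) (f g k r t : isom U) (A X Y Q : seq U).
Implicit Types s : nat -> isom U.

(** The conjugator is built one point of [X] at a time, each new image being
    chosen by [free_image]. *)
Lemma free_conj t Y X : half_isom t -> exists k, {in Y, forall x, k x = x} /\
  {in Y ++ X &, forall x z, 1 / 2 <= d (k x) (t (k z)) \/
    exists u v, [/\ u \in Y, v \in Y &
      d x u + d u (t v) + d v z <= d (k x) (t (k z))]}.
Proof.
move=> t_half; elim: X => [|a X [k [kY kX]]].
  exists 1%g; split=> // x z; rewrite cats0 => xY zY; right.
  by exists x, z; split=> //; rewrite !mdistxx add0r addr0.
pose P := Y ++ X.
have [c [cP ctP ctVP cc]] := free_image hU [seq k x | x <- P] (k a) t_half.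
have {}cP y : y \in P -> d c (k y) = d a y.
  by move=> yP; rewrite cP ?map_f// dist_isom.
have [k' [k'P k'a]] := @isom_extend _ _ hU P k a c cP.
exists k'; split=> [x xY|x z]; first by rewrite k'P ?kY// mem_cat xY.
have memP w : w \in Y ++ a :: X -> w = a \/ w \in P.
  by rewrite !mem_cat inE => /or3P[->|/eqP->|->]; rewrite ?orbT; auto.
move=> /memP[->|xP] /memP[->|zP]; rewrite ?k'a ?(k'P x)// ?(k'P z)//.
- case: cc => [|[_ [_ [/mapP[y yP ->] /mapP[y' y'P ->]]]]]; first by left.
  rewrite !dist_isom => le_c.
  have [?|[u [v [uY vY le_uv]]]] := kX _ _ yP y'P; [left|right].
    by have := mdist_ge0 a y; have := mdist_ge0 y' a; lra.
  exists u, v; split=> //.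
  by have := metric_triangle a y u; have := metric_triangle v y' a; lra.
- have [|[_ /mapP[y yP ->]]] := ctP _ (map_f k zP); first by left; lra.
  rewrite cP// => le_c.
  have [?|[u [v [uY vY le_uv]]]] := kX _ _ yP zP; [left|right].
    by have := mdist_ge0 a y; lra.
  by exists u, v; split=> //; have := metric_triangle a y u; lra.
- rewrite -dist_isomV metric_sym.
  have [|[_ /mapP[y yP ->]]] := ctVP _ (map_f k xP); first by left; lra.
  rewrite cP// (metric_sym (k y)) dist_isomV => le_c.
  have [?|[u [v [uY vY le_uv]]]] := kX _ _ xP yP; [left|right].
    by have := mdist_ge0 a y; lra.
  exists u, v; split=> //; have := metric_triangle v y a.
  by rewrite (metric_sym y a); lra.
- exact: kX.
Qed.

(** The conjugate of [free_conj], followed by a free move over [X]. *)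
Lemma generic_conj t Y X Q : half_isom t -> {subset Y <= X} ->
  exists k, [/\ {in Y, forall x, k x = x},
    {in X &, forall x z, 1 / 2 <= d x ((t ^ k)%g z) \/
      exists u v, [/\ u \in Y, v \in Y &
        d x u + d u (t v) + d v z <= d x ((t ^ k)%g z)]} &
    {in X & Q, forall x y, indep X ((t ^ k)%g x) y}].
Proof.
move=> t_half YX; have [k [kY kX]] := free_conj Y X t_half.
have [l [lX lQ]] := free_move hU X [seq (t ^ k)%g x | x <- X] Q.
have lVX x : x \in X -> (l^-1)%g x = x by move=> xX; rewrite -{1}(lX x)// isomK.
have tklE x : x \in X -> (t ^ (k * l^-1))%g x = l ((t ^ k)%g x).
  by move=> xX; rewrite conjgM [LHS]isomJ invgK lVX.
exists (k * l^-1)%g; split=> [x xY|x z xX zX|x y xX yQ].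
- by rewrite isomM lVX ?YX// kY.
- rewrite tklE// -(lX x xX) !dist_isom isomJ dist_isomVr (lX x xX).
  by apply: kX; rewrite mem_cat ?xX ?zX orbT.
- by rewrite tklE//; apply: lQ => //; exact: map_f.
Qed.

(** [run s n] applies [s 0], ..., [s n.-1] in that order. *)
Fixpoint run s n : isom U := if n is n'.+1 then (s n' * run s n')%g else 1%g.

Lemma runS s n x : run s n.+1 x = s n (run s n x). Proof. by []. Qed.

Definition conj_over A s s' :=
  forall i, exists2 k : isom U, {in A, forall x, k x = x} & s' i = (s i ^ k)%g.

Lemma conj_over_refl A s : conj_over A s s.
Proof. by move=> i; exists 1%g => //; rewrite conjg1. Qed.

Lemma conj_over_trans A s s' s'' :
  conj_over A s s' -> conj_over A s' s'' -> conj_over A s s''.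
Proof.
move=> ss' ss'' i; have [k kA kE] := ss' i; have [l lA lE] := ss'' i.
exists (k * l)%g; first by move=> x xA; rewrite isomM lA ?kA.
by rewrite lE kE conjgM.
Qed.

Lemma conj_over_half A s s' : conj_over A s s' ->
  (forall i, half_isom (s i)) -> forall i, half_isom (s' i).
Proof. by move=> ss' hs i; have [k _ ->] := ss' i; exact: half_isomJ. Qed.

(** The conjugators are frozen on [A], which therefore has to take part, at every
    level, in the orbits that describe the chain. *)
Definition anchored A X s m :=
  forall i, (i <= m)%N -> {subset A <= [seq run s i x | x <- X]}.

Definition consecutive_indep A s m := forall i, (i.+1 < m)%N ->
  {in A &, forall x y, indep A (s i x) ((s i.+1)^-1%g y)}.

(** Step [i] of the chain, on the orbits of [X], creates no proximity besides the
    one forced by its behaviour on [A] and on the preimage of [A], and the new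
    level depends on earlier levels only through the level just before it. *)
Definition generic_step A X s i := {in X &, forall x z,
  (1 / 2 <= d (run s i x) (run s i.+1 z) \/
   exists u v, [/\ u \in A ++ [seq (s i)^-1%g y | y <- A],
     v \in A ++ [seq (s i)^-1%g y | y <- A] &
     d (run s i x) u + d u (s i v) + d v (run s i z)
       <= d (run s i x) (run s i.+1 z)]) /\
  forall j, (j < i)%N ->
    indep [seq run s i y | y <- X] (run s j x) (run s i.+1 z)}.

Lemma fix_isomV A k : {in A, forall x, k x = x} -> {in A, forall x, (k^-1)%g x = x}.
Proof. by move=> kA x xA; rewrite -{1}(kA x)// isomK. Qed.

Lemma consecutive_indep_exists A s m :
  exists s', conj_over A s s' /\ consecutive_indep A s' m.
Proof.
elim: m => [|m [s' [ss' s'A]]]; first by exists s; split; [exact: conj_over_refl|].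
have [k [kA kS]] := free_move hU A [seq (s' m)^-1%g y | y <- A]
  [seq s' m.-1 x | x <- A].
pose s'' j := if j == m then (s' j ^ k^-1)%g else s' j.
exists s''; split.
  apply: conj_over_trans ss' _ => i; rewrite /s''; case: eqP => _.
    by exists (k^-1)%g => //; exact: fix_isomV.
  by exists 1%g => //; rewrite conjg1.
move=> i; rewrite ltnS leq_eqVlt => /orP[/eqP im|im] x y xA yA; last first.
  by rewrite /s'' !ltn_eqF ?(ltnW im)//; exact: s'A.
rewrite /s'' im eqxx -{1}im ltn_eqF// -conjVg isomJ invgK.
rewrite (fix_isomV kA)//; apply/indepC/kS; first exact: map_f.
by rewrite -im /= map_f.
Qed.

(** Step [i] is put in general position by conjugating it over [A] and the
    preimage of [A]. Each later level is thereby moved by an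
    isometry [r] that fixes [A], so the later steps are conjugated by [r]. *)
Lemma generic_next A X s i m : (i < m)%N ->
    (forall j, half_isom (s j)) -> anchored A X s m -> consecutive_indep A s m ->
    (forall j, (j < i)%N -> generic_step A X s j) ->
  exists s', [/\ conj_over A s s', anchored A X s' m, consecutive_indep A s' m &
    forall j, (j < i.+1)%N -> generic_step A X s' j].
Proof.
move=> im s_half sA s_indep s_gen.
pose t := s i; pose Y := A ++ [seq (t^-1)%g y | y <- A].
pose X' := [seq run s i x | x <- X].
have YX' : {subset Y <= X'}.
  move=> y; rewrite mem_cat => /orP[|/mapP[z zA ->]]; first exact/sA/ltnW.
  have /mapP[x xX ->] := sA _ im _ zA.
  by rewrite runS isomK map_f.
pose Q := [seq run s j x | j <- iota 0 i, x <- X].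
have [k [kY kX kQ]] := generic_conj Q (s_half i) YX'.
rewrite -/t in kX kQ.
have [r [tkE rA]] : exists r, (t ^ k = r * t)%g /\ {in A, forall x, r x = x}.
  exists ((t ^ k) * t^-1)%g; split=> [|x xA]; first by rewrite mulgVK.
  rewrite isomM isomJ kY ?mem_cat ?map_f ?orbT// isomVK.
  by rewrite (fix_isomV kY)// mem_cat xA.
pose s' j := if (j < i)%N then s j else if j == i then (t ^ k)%g else (s j ^ r^-1)%g.
have s'lt j : (j < i)%N -> s' j = s j by rewrite /s' => ->.
have s'i : s' i = (t ^ k)%g by rewrite /s' ltnn eqxx.
have s'gt j : (i < j)%N -> s' j = (s j ^ r^-1)%g.
  by move=> ij; rewrite /s' ltnNge (ltnW ij)/= gtn_eqF.
have s'A j x : (i <= j)%N -> x \in A -> s' j x = r (s j x).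
  rewrite leq_eqVlt => /orP[/eqP<-|ij] xA; first by rewrite s'i tkE.
  by rewrite s'gt// isomJ invgK (fix_isomV rA).
have s'VA j x : (i < j)%N -> x \in A -> (s' j)^-1%g x = r ((s j)^-1%g x).
  by move=> ij xA; rewrite s'gt// -conjVg isomJ invgK (fix_isomV rA).
have s'iV x : x \in A -> (s' i)^-1%g x = (s i)^-1%g x.
  by move=> xA; rewrite s'i tkE invgM isomM (fix_isomV rA).
have run_le j : (j <= i)%N -> run s' j = run s j.
  by elim: j => //= j IH ji; rewrite IH ?(ltnW ji)// s'lt.
have run_gt j : (i < j)%N -> run s' j = (r * run s j)%g.
  elim: j => // j IH; rewrite ltnS leq_eqVlt => /orP[/eqP<-|ij].
    by rewrite /= run_le// s'i tkE mulgA.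
  by rewrite /= IH// s'gt// conjgE invgK -!mulgA mulKg.
exists s'; split.
- move=> j; rewrite /s'; case: ltnP => _; first by exists 1%g; rewrite ?conjg1.
  case: eqP => [->|_]; last by exists (r^-1)%g => //; exact: fix_isomV.
  by exists k => // x xA; rewrite kY// mem_cat xA.
- move=> j jm x xA; have [ji|ij] := leqP j i; first by rewrite run_le// sA.
  have /mapP[y yX xE] := sA _ jm _ xA; apply/mapP; exists y => //.
  by rewrite run_gt// isomM -xE rA.
- move=> j jm x y xA yA; have ind := s_indep _ jm _ _ xA yA.
  have [ij|] := leqP i j.
    by rewrite s'A// s'VA// indep_fixed.
  rewrite leq_eqVlt => /orP[/eqP ji|ji]; rewrite s'lt ?(ltnW ji)// -?ji//.
    by rewrite ji s'iV// -ji.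
  by rewrite s'lt.
move=> j; rewrite ltnS leq_eqVlt => /orP[/eqP->|ji]; last first.
  rewrite /generic_step s'lt// !run_le// ?(ltnW ji)// => x z xX zX.
  have [h1 h2] := s_gen _ ji _ _ xX zX; split=> // l lj.
  by rewrite run_le ?(ltnW (ltn_trans lj ji))//; exact: h2.
move=> x z xX zX; rewrite runS run_le// s'i.
have YE : A ++ [seq (s' i)^-1%g y | y <- A] = Y.
  by congr (_ ++ _); apply/eq_in_map => y yA; rewrite s'iV.
split; last first.
  move=> l li; rewrite run_le ?(ltnW li)//; apply/indepC/kQ; first exact: map_f.
  by apply/allpairsP; exists (l, x); rewrite mem_iota.
have [|[u [v [uY vY le_uv]]]] := kX _ _ (map_f (run s i) xX) (map_f (run s i) zX).
  by left.
right; exists u, v; rewrite -s'i YE; split=> //; rewrite s'i.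
by rewrite isomJ kY// dist_isomVr kY.
Qed.

(** Over at least four steps of a chain in general position, the only dependence
    left is the one through [A]. *)
Section Decay.
Variables (A X : seq U) (s : nat -> isom U) (m : nat).
Variable s_indep : consecutive_indep A s m.
Variable s_gen : forall i, (i < m)%N -> generic_step A X s i.

(** Two consecutive short steps meet in a pair of points [s i v] and [s i.+1^-1 y]
    with [v] and [y] in [A], which are independent over [A]. *)
Lemma two_steps i x y z : (i.+1 < m)%N -> x \in X -> y \in X -> z \in X ->
  let D := d (run s i x) (run s i.+1 y) + d (run s i.+1 y) (run s i.+2 z) in
  1 / 2 <= D \/ exists2 a : U, a \in A & d (run s i x) a + d a (run s i.+2 z) <= D.
Proof.
move=> im xX yX zX; cbv zeta.
set p := run s i x; set q := run s i.+1 y; set w := run s i.+2 z.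
have pq0 := mdist_ge0 p q; have qw0 := mdist_ge0 q w.
have [[pq|[u [v [_ vY pq]]]] _] := s_gen (ltnW im) xX yX.
  by left; rewrite -/p -/q in pq; lra.
have [[qw|[u' [v' [u'Y v'Y qw]]]] _] := s_gen im yX zX.
  by left; rewrite -/q -/w in qw; lra.
rewrite -/p -(dist_isom (s i) v) -runS -/q in pq.
rewrite -/q -(dist_isom (s i.+1) v') -runS -/w in qw.
have pv : d p (s i v) <= d p u + d u (s i v) by exact: metric_triangle.
move: u'Y; rewrite mem_cat => /orP[u'A|/mapP[b bA u'E]].
  right; exists u' => //; have := metric_triangle p q u'.
  have := metric_triangle u' (s i.+1 v') w; lra.
move: vY; rewrite mem_cat => /orP[vA|/mapP[b' b'A vE]]; last first.
  right; exists (s i v); first by rewrite vE isomVK.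
  by have := metric_triangle (s i v) q w; lra.
have vu' : d (s i v) u' <= d (s i v) q + d q u' by exact: metric_triangle.
have u'w : d u' w <= d u' (s i.+1 v') + d (s i.+1 v') w by exact: metric_triangle.
have p0 := mdist_ge0 p (s i v); have w0 := mdist_ge0 u' w.
have := s_indep im vA bA; rewrite -u'E => -[?|[a aA le_a]]; first by left; lra.
right; exists a => //.
by have := metric_triangle p (s i v) a; have := metric_triangle a u' w; lra.
Qed.

(** Every pair at distance less than 1 factors through the last two levels. *)
Let factor i j x z : (i <= j)%N -> (j.+2 <= m)%N -> x \in X -> z \in X ->
  1 <= d (run s i x) (run s j.+2 z) \/
  exists y y', [/\ y \in X, y' \in X &
    d (run s i x) (run s j y) + (d (run s j y) (run s j.+1 y') +
    d (run s j.+1 y') (run s j.+2 z)) <= d (run s i x) (run s j.+2 z)].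
Proof.
move=> ij jm xX zX; have [_ /(_ i)] := s_gen jm xX zX.
rewrite ltnS ij => /(_ isT)[|[_ /mapP[y' y'X ->] le_y']]; first by left.
move: ij; rewrite leq_eqVlt => /orP[/eqP ij|ij].
  by right; exists x, y'; split=> //; rewrite -ij in le_y' *; rewrite mdistxx add0r.
have [_ /(_ i ij)[|[_ /mapP[y yX ->] le_y]]] := s_gen (ltnW jm) xX y'X.
  by left; have := mdist_ge0 (run s j.+1 y') (run s j.+2 z); lra.
by right; exists y, y'; split=> //; lra.
Qed.

Lemma half_decay i j x z : (i.+2 <= j)%N -> (j <= m)%N -> x \in X -> z \in X ->
  1 / 2 <= d (run s i x) (run s j z) \/
  exists2 a : U, a \in A & d (run s i x) a + d a (run s j z) <= d (run s i x) (run s j z).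
Proof.
case: j => [|[|j]]//; rewrite !ltnS => ij jm xX zX.
have [|[y [y' [yX y'X le_y]]]] := factor ij jm xX zX; first by left; lra.
have xy0 := mdist_ge0 (run s i x) (run s j y).
have [|[a aA le_a]] := two_steps jm yX y'X zX; first by left; lra.
right; exists a => //.
by have := metric_triangle (run s i x) (run s j y) a; lra.
Qed.

Lemma decay i j x z : (i + 4 <= j)%N -> (j <= m)%N -> x \in X -> z \in X ->
  indep A (run s i x) (run s j z).
Proof.
rewrite !addnS addn0; case: j => [|[|j]]//; rewrite !ltnS => ij jm xX zX.
have ij' : (i <= j)%N by rewrite (leq_trans _ ij)// -addn2 leq_addr.
have [|[y [y' [yX y'X le_y]]]] := factor ij' jm xX zX; first by left.
have [|[a aA le_a]] := two_steps jm yX y'X zX; last first.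
  right; exists a => //.
  by have := metric_triangle (run s i x) (run s j y) a; lra.
move=> half; have [|[a aA le_a]] := half_decay ij (ltnW (ltnW jm)) xX yX.
  by left; lra.
right; exists a => //.
have := metric_triangle a (run s j y) (run s j.+2 z).
by have := metric_triangle (run s j y) (run s j.+1 y') (run s j.+2 z); lra.
Qed.

End Decay.

End GeneralPosition.

(** * Prescribing the image of one more point *)

Section Prescribing.
Context {R : realType} {U : metricType R}.
Variable hU : is_bounded_urysohn U.
Implicit Types (x y z : U) (f g k r t : isom U) (A X Y Z B : seq U).
Implicit Types s : nat -> isom U.

(** A new point of a level that copies the type of [a] and lies within 1/2 of
    the points of [B], which are its neighbours in the chain. *)
Lemma linked_point B X Z (v : U -> U) a :
    {in X &, forall x y, d (v x) (v y) = d x y} ->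
    {in B & X, forall b x, d b (v x) <= 1 / 2 + d a x /\ d a x <= 1 / 2 + d b (v x)} ->
  exists c, [/\ {in X, forall x, d c (v x) = d a x},
    {in B, forall b, d c b <= 1 / 2} &
    {in Z, forall z, [\/ 1 <= d c z, exists2 b, b \in B & 1 / 2 + d b z <= d c z |
      exists2 x, x \in X & d c (v x) + d (v x) z <= d c z]}].
Proof.
move=> vX Bv.
pose L := [seq (b, 1 / 2) | b <- B] ++ [seq (v x, d a x) | x <- X].
have inL p : p \in L -> (exists2 b, b \in B & p = (b, 1 / 2)) \/
    exists2 x, x \in X & p = (v x, d a x).
  by rewrite mem_cat => /orP[] /mapP[x xB ->]; [left|right]; exists x.
have [|c [cL cZ]] := @free_point _ _ hU L ([seq v x | x <- X] ++ Z).
  move=> p p' /inL[[b bB ->]|[x xX ->]] /inL[[b' b'B ->]|[y yX ->]] /=.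
  - by have := dist_le1 hU b b'; lra.
  - by have [] := Bv _ _ bB yX.
  - by rewrite metric_sym addrC; have [] := Bv _ _ b'B xX.
  - by rewrite vX// (metric_sym a x) metric_triangle.
have cB : {in B, forall b, d c b <= 1 / 2}.
  by move=> b bB; apply: (cL (b, 1 / 2)); rewrite mem_cat (map_f (fun b => (b, 1 / 2))).
have cX : {in X, forall x, d c (v x) = d a x}.
  move=> x xX; apply/eqP; rewrite eq_le; apply/andP; split.
    apply: (cL (v x, d a x)).
    by rewrite mem_cat (map_f (fun x => (v x, d a x)))// orbT.
  have [|/(le_trans (dist_le1 hU a x))//|[p /inL]] := cZ (v x).
    by rewrite mem_cat map_f.
  move=> [[b bB ->]|[y yX ->]] /=; first by have [] := Bv _ _ bB xX; lra.
  by rewrite vX//; have := metric_triangle a y x; lra.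
exists c; split=> // z zZ.
have [||[p /inL[[b bB ->]|[x xX ->]]]] := cZ z; first by rewrite mem_cat zZ orbT.
- by constructor 1.
- by constructor 2; exists b.
- by constructor 3; exists x => //; rewrite cX.
Qed.

(** A conjugate of [t] that agrees with [t] on [X] can map [p] to [p'] as soon as
    the position of the pair over [X] and its image is the one that [free_image]
    provides. *)
Lemma step_through t X p p' : half_isom t ->
    {in X, forall x, d p' (t x) = d p x} ->
    {in X, forall x, indep X p (t x)} ->
    {in X, forall x, indep [seq t x | x <- X] p' x} ->
    d p p' <= 1 / 2 ->
    (1 / 2 <= d p p' \/ exists x y, [/\ x \in X, y \in X &
      d p x + d x (t y) + d (t y) p' <= d p p']) ->
  exists k, {in X ++ [seq t x | x <- X], forall x, k x = x} /\ (t ^ k)%g p = p'.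
Proof.
move=> t_half p'X pX p'X' pp' pp'_free.
have [c [cX ctX ctVX cc]] := free_image hU X p t_half.
pose P := X ++ [seq t x | x <- X].
have cP : {in P, forall z, d c z = d p z}.
  move=> z; rewrite mem_cat => /orP[/cX//|/mapP[x xX ->]].
  by apply: (@indep_unique _ _ hU X) => //; [exact: ctX|exact: pX].
have [|k [kP kp]] := @isom_extend _ _ hU P 1%g p c; first exact: cP.
have cc' : d (t c) c = d p' p.
  have le_tc : d c (t c) <= 1 / 2 by have [t12 _] := t_half; exact: t12.
  rewrite metric_sym (metric_sym p'); apply/eqP; rewrite eq_le; apply/andP; split.
    case: pp'_free => [|[x [y [xX yX]]]]; first lra.
    have := metric_triangle c x (t c); have := metric_triangle x (t y) (t c).
    rewrite (cX x xX) dist_isom (metric_sym y c) (cX y yX) (metric_sym (t y) p').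
    by rewrite (p'X y yX); lra.
  case: cc => [|[x [y [xX yX]]]]; first lra.
  have := metric_triangle p x p'; have := metric_triangle x (t y) p'.
  by rewrite (metric_sym (t y) p') (p'X y yX) (metric_sym y p); lra.
have [|l [lP lp']] := @isom_extend _ _ hU (p :: P) k p' (t c).
  move=> z; rewrite inE => /orP[/eqP->|zP]; first by rewrite kp.
  rewrite kP// isom1; move: zP; rewrite mem_cat => /orP[zX|/mapP[x xX ->]].
    apply: (@indep_unique _ _ hU [seq t x | x <- X]); last exact: p'X'.
      by move=> _ /mapP[x xX ->]; rewrite dist_isom cX ?p'X.
    rewrite -(isomVK t z); apply/indep_isom; exact: ctVX.
  by rewrite dist_isom cX ?p'X.
exists l; split=> [x xP|].
  by rewrite lP ?inE ?xP ?orbT// kP// isom1.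
by rewrite isomJ lP ?inE ?eqxx// kp -lp' isomK.
Qed.

Definition level X s i := [seq run s i x | x <- X].

(** Four steps separate a level next to one end from the other end of a chain of
    six steps, so the last two conditions are what [decay] provides. They allow
    the interior of the chain to be re-embedded once the images of new points of
    level 0 are known. *)
Definition ready A X s := [/\ anchored A X s 6,
  forall i, (1 <= i <= 2)%N ->
    {in X &, forall x z, indep X (run s i x) (run s 6 z)} &
  forall i, (4 <= i <= 5)%N ->
    {in X &, forall x z, indep (level X s 6) (run s i x) z}].

(** A new pair ([a], [a']) of end points of the chain. *)
Section NewOrbit.
Variables (A X : seq U) (s : nat -> isom U) (a a' : U).
Variable s_half : forall i, half_isom (s i).
Variable s_ready : ready A X s.
Variable aa' : {in X, forall x, d a' (run s 6 x) = d a x}.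

(** The interior levels can be moved, without moving the two ends, so as to
    become independent from the new pair over the ends. *)
Lemma interior_moved : exists s', [/\ conj_over A s s', ready A X s',
  {in X, run s' 6 =1 run s 6},
  forall i, (1 <= i <= 2)%N -> {in X, forall x,
    indep X (run s' i x) a /\ indep X (run s' i x) a'} &
  forall i, (4 <= i <= 5)%N -> {in X, forall x,
    indep (level X s' 6) (run s' i x) a /\ indep (level X s' 6) (run s' i x) a'}].
Proof.
have [sA s12 s45] := s_ready.
have [k [kC kE]] := free_move hU (X ++ level X s 6)
  [seq run s i x | i <- iota 1 5, x <- X] [:: a; a'].
pose s' i := (s i ^ k^-1)%g.
have kX : {in X, forall x, k x = x} by move=> x xX; rewrite kC// mem_cat xX.
have k6 : {in level X s 6, forall x, k x = x}.
  by move=> x xX; rewrite kC// mem_cat xX orbT.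
have s'E i x : x \in X -> run s' i x = k (run s i x).
  move=> xX; elim: i => [|i IH]; first by rewrite /= kX.
  by rewrite !runS IH /s' isomJ invgK isomK.
have s'6 x : x \in X -> run s' 6 x = run s 6 x.
  by move=> xX; rewrite s'E// k6// map_f.
have lvl6 : level X s' 6 = level X s 6 by apply/eq_in_map => x /s'6.
have kA : {in A, forall x, k x = x}.
  by move=> x xA; apply: kX; have /mapP[y yX ->] := sA 0%N isT _ xA.
have freeE i x : (1 <= i <= 5)%N -> x \in X ->
    indep (X ++ level X s 6) (run s' i x) a /\
    indep (X ++ level X s 6) (run s' i x) a'.
  move=> i15 xX; rewrite s'E//.
  have inE6 : run s i x \in [seq run s i x | i <- iota 1 5, x <- X].
    by apply/allpairsP; exists (i, x); rewrite mem_iota.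
  by split; apply: kE; rewrite // !inE eqxx ?orbT.
have s'12 i : (1 <= i <= 2)%N ->
    {in X &, forall x z, indep X (run s' i x) (run s' 6 z)}.
  move=> i12 x z xX zX; rewrite s'6// -(k6 (run s 6 z)) ?map_f// s'E//.
  by apply/(indep_fixed _ _ kX); exact: s12.
have s'45 i : (4 <= i <= 5)%N ->
    {in X &, forall x z, indep (level X s 6) (run s' i x) z}.
  move=> i45 x z xX zX; rewrite -(kX z)// s'E//.
  by apply/(indep_fixed _ _ k6); exact: s45.
exists s'; split=> //.
- by move=> i; exists (k^-1)%g => //; exact: fix_isomV.
- split=> //; last by rewrite lvl6.
  move=> i i6 x xA; have /mapP[y yX xE] := sA i i6 x xA.
  by apply/mapP; exists y; rewrite // s'E// -xE kA.
- move=> i i12 x xX; have [|ia ia'] := freeE i x _ xX.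
    by case/andP: i12 => -> /leq_trans->.
  split; [apply: indep_trans ia _|apply: indep_trans ia' _] => z;
    rewrite mem_cat => /orP[zX|/mapP[y yX ->]];
    by [exact: indep_mem|rewrite -s'6//; exact: s'12].
- move=> i i45 x xX; have [|ia ia'] := freeE i x _ xX.
    by case/andP: i45 => /(leq_trans _)-> // ->.
  rewrite lvl6; split; [apply: indep_trans ia _|apply: indep_trans ia' _] => z;
    rewrite mem_cat => /orP[zX|zX];
    by [exact: s'45|exact: indep_mem].
Qed.

Variable free12 : forall i, (1 <= i <= 2)%N -> {in X, forall x,
  indep X (run s i x) a /\ indep X (run s i x) a'}.
Variable free45 : forall i, (4 <= i <= 5)%N -> {in X, forall x,
  indep (level X s 6) (run s i x) a /\ indep (level X s 6) (run s i x) a'}.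

Let run_half i x : d (run s i x) (run s i.+1 x) <= 1 / 2.
Proof. by have [s12 _] := s_half i; exact: s12. Qed.

Let run_isom i : {in X &, forall x y, d (run s i x) (run s i y) = d x y}.
Proof. by move=> x y _ _; exact: dist_isom. Qed.

Let T := [seq run s i x | i <- iota 0 7, x <- X] ++ [:: a; a'].

Let T_run i x : (i <= 6)%N -> x \in X -> run s i x \in T.
Proof.
move=> i6 xX; rewrite mem_cat; apply/orP; left.
by apply/allpairsP; exists (i, x); rewrite mem_iota.
Qed.

Let T_X x : x \in X -> x \in T. Proof. exact: (@T_run 0). Qed.

Let T_a : a \in T. Proof. by rewrite mem_cat !inE eqxx orbT. Qed.

Let T_a' : a' \in T. Proof. by rewrite mem_cat !inE eqxx !orbT. Qed.

(** All steps are isometries, so the new orbit keeps at every level the distances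
    that [a] has to the orbits of [X] at level 0. *)
Let tracks i p := {in X, forall x, d p (run s i x) = d a x}.

(** A path that makes one step of the chain along the new orbit is no shorter
    than the one that makes this step along an old orbit. *)
Let shift i j p p' x z : tracks i p -> tracks j p' -> x \in X ->
  d (run s i x) (run s j x) <= 1 / 2 ->
  d p (run s i x) + d (run s i x) z <= d p z ->
  d p' (run s j x) + d (run s j x) z <= 1 / 2 + d p z.
Proof.
move=> pi p'j xX ij; rewrite pi// p'j//.
have := metric_triangle (run s j x) (run s i x) z.
by rewrite (metric_sym (run s j x) (run s i x)); lra.
Qed.

Let push i p : tracks i p ->
    {in T, forall z, 1 / 2 <= d p z \/
      exists2 x, x \in X & d p (run s i x) + d (run s i x) z <= d p z} ->
  exists p', [/\ tracks i.+1 p', d p p' <= 1 / 2,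
    {in T, forall z, indep (level X s i.+1) p' z} &
    1 / 2 <= d p' p \/
    exists2 x, x \in X & d p' (run s i.+1 x) + d (run s i.+1 x) p <= d p' p].
Proof.
move=> p_tr pT.
have [|c [c_tr cp cZ]] :=
    @linked_point [:: p] X (p :: T) (run s i.+1) a (run_isom _).
  move=> b x; rewrite inE => /eqP-> xX; rewrite -p_tr//.
  have := metric_triangle p (run s i x) (run s i.+1 x).
  have := metric_triangle p (run s i.+1 x) (run s i x).
  by rewrite (metric_sym (run s i.+1 x)); have := run_half i x; lra.
exists c; split=> //; first by rewrite metric_sym cp// inE.
  move=> z zT; have [||[b]|[x xX le_x]] := cZ z; first by rewrite inE zT orbT.
  - by left.
  - rewrite inE => /eqP-> le_z; have [|[x xX le_x]] := pT _ zT; first by left; lra.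
    right; exists (run s i.+1 x); first exact: map_f.
    by apply: le_trans le_z; apply: shift le_x.
  - by right; exists (run s i.+1 x) => //; exact: map_f.
have [||[b]|[x xX le_x]] := cZ p; first by rewrite inE eqxx.
- by left; lra.
- by rewrite inE => /eqP->; rewrite mdistxx; left; lra.
- by right; exists x.
Qed.

Let neighbours i p p' :
    {in X, forall x, indep (level X s i) p (run s i.+1 x)} ->
    (1 / 2 <= d p' p \/
    exists2 x, x \in X & d p' (run s i.+1 x) + d (run s i.+1 x) p <= d p' p) ->
  1 / 2 <= d p p' \/ exists x y, [/\ x \in X, y \in X &
    d p (run s i x) + d (run s i x) (run s i.+1 y) + d (run s i.+1 y) p'
      <= d p p'].
Proof.
move=> pX; rewrite (metric_sym p') => -[|[y yX le_y]]; first by left.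
have [py|[_ /mapP[x xX ->] le_x]] := pX _ yX.
  by left; have := mdist_ge0 p' (run s i.+1 y);
     rewrite (metric_sym p) in py; lra.
right; exists x, y; split=> //.
rewrite (metric_sym (run s i.+1 y) p') .
by rewrite (metric_sym (run s i.+1 y) p) in le_y; lra.
Qed.

(** The levels 2, 3 and 4 of the new orbit are obtained by pushing; the first one
    still depends on [a], and the last one has to be linked to [a'] as well. *)
Lemma chain_points : exists p : nat -> U, [/\ p 0%N = a, p 6 = a',
  forall i, (i < 6)%N -> [/\ {in X, forall x, d (p i.+1) (run s i.+1 x) = d (p i) (run s i x)},
    {in X, forall x, indep (level X s i) (p i) (run s i.+1 x)},
    {in X, forall x, indep (level X s i.+1) (p i.+1) (run s i x)},
    d (p i) (p i.+1) <= 1 / 2 &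
    1 / 2 <= d (p i) (p i.+1) \/ exists x y, [/\ x \in X, y \in X &
      d (p i) (run s i x) + d (run s i x) (run s i.+1 y) + d (run s i.+1 y) (p i.+1)
        <= d (p i) (p i.+1)]],
  forall i, (1 <= i <= 2)%N -> {in a' :: level X s 6, forall z, indep (a :: X) (p i) z} &
  forall i, (4 <= i <= 5)%N -> {in a :: X, forall z, indep (a' :: level X s 6) (p i) z}].
Proof.
have [sA s12 s45] := s_ready.
have a_tr : tracks 0 a by [].
have a'_tr : tracks 6 a' by [].
have aX i x : (1 <= i <= 2)%N -> x \in X -> indep X a (run s i x).
  by move=> i12 xX; apply: indepC; have [] := free12 i12 xX.
have a'X i x : (4 <= i <= 5)%N -> x \in X -> indep (level X s 6) a' (run s i x).
  by move=> i45 xX; apply: indepC; have [] := free45 i45 xX.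
have [|p1 [p1_tr p1a p1T]] := @linked_point [:: a] X T (run s 1) a (run_isom _).
  move=> b x; rewrite inE => /eqP-> xX.
  have := metric_triangle a x (run s 1 x); have := metric_triangle a (run s 1 x) x.
  by rewrite (metric_sym (run s 1 x)); have := run_half 0 x; rewrite [run s 0 x]/=; lra.
have {}p1a : d p1 a <= 1 / 2 by apply: p1a; rewrite inE.
have {}p1T z : z \in T -> [\/ 1 <= d p1 z, 1 / 2 + d a z <= d p1 z |
    exists2 x, x \in X & d p1 (run s 1 x) + d (run s 1 x) z <= d p1 z].
  move=> /p1T[|[b]|]; first by constructor 1.
    by rewrite inE => /eqP->; constructor 2.
  by constructor 3.
have p1_indep z : z \in T -> indep X a z -> indep (level X s 1) p1 z.
  move=> zT az; have [?|le_z|[x xX ?]] := p1T z zT; first by left.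
    case: az => [?|[x xX le_x]]; first by left; lra.
    right; exists (run s 1 x); first exact: map_f.
    by apply: le_trans le_z; apply: (@shift 0) le_x => //; exact: run_half.
  by right; exists (run s 1 x) => //; exact: map_f.
have [|p2 [p2_tr p12 p2T p2p1]] := push p1_tr.
  move=> z /p1T[||]; [left; lra|left; have := mdist_ge0 a z; lra|by right].
have strong i p : {in T, forall z, indep (level X s i) p z} ->
    {in T, forall z, 1 / 2 <= d p z \/
      exists2 x, x \in X & d p (run s i x) + d (run s i x) z <= d p z}.
  move=> pT z /pT[|[_ /mapP[x xX ->]]]; first by left; lra.
  by right; exists x.
have [p3 [p3_tr p23 p3T p3p2]] := push p2_tr (strong _ _ p2T).
have [p4 [p4_tr p34 p4T p4p3]] := push p3_tr (strong _ _ p3T).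
have [|p5 [p5_tr p5B p5T]] :=
    @linked_point [:: p4; a'] X (p4 :: T) (run s 5) a (run_isom _).
  have close i p x : tracks i p -> x \in X -> d (run s i x) (run s 5 x) <= 1 / 2 ->
      d p (run s 5 x) <= 1 / 2 + d a x /\ d a x <= 1 / 2 + d p (run s 5 x).
    move=> p_tr xX; rewrite -p_tr//.
    have := metric_triangle p (run s i x) (run s 5 x).
    have := metric_triangle p (run s 5 x) (run s i x).
    by rewrite (metric_sym (run s 5 x)); lra.
  move=> b x; rewrite !inE => /orP[]/eqP-> xX; first exact: close p4_tr _ _.
  by apply: close a'_tr _ _; rewrite // metric_sym.
have p54 : d p5 p4 <= 1 / 2 by apply: p5B; rewrite inE eqxx.
have p5a' : d p5 a' <= 1 / 2 by apply: p5B; rewrite !inE eqxx orbT.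
have {}p5T z : z \in p4 :: T -> [\/ 1 <= d p5 z, 1 / 2 + d p4 z <= d p5 z,
    1 / 2 + d a' z <= d p5 z |
    exists2 x, x \in X & d p5 (run s 5 x) + d (run s 5 x) z <= d p5 z].
  move=> /p5T[|[b]|]; first by constructor 1.
    by rewrite !inE => /orP[]/eqP->; [constructor 2|constructor 3].
  by constructor 4.
(* The only dependence of level 5 besides its own level is the one through a'. *)
have p5_cases z : z \in T ->
    indep (level X s 5) p5 z \/ 1 / 2 + d a' z <= d p5 z.
  move=> zT; have [|?|le_z|?|[x xX ?]] := p5T z; first by rewrite inE zT orbT.
  - by left; left.
  - left; have [?|[_ /mapP[x xX ->] le_x]] := p4T z zT; first by left; lra.
    right; exists (run s 5 x); first exact: map_f.
    by apply: le_trans le_z; apply: shift le_x.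
  - by right.
  - by left; right; exists (run s 5 x) => //; exact: map_f.
have p5_indep z : z \in T -> indep (level X s 6) a' z -> indep (level X s 5) p5 z.
  move=> zT a'z; have [//|le_z] := p5_cases z zT.
  case: a'z => [?|[_ /mapP[x xX ->] le_x]]; first by left; lra.
  right; exists (run s 5 x); first exact: map_f.
  by apply: le_trans le_z; apply: shift le_x => //; rewrite metric_sym.
have lvl i x : x \in X -> run s i x \in level X s i by exact: map_f.
exists (nth a [:: a; p1; p2; p3; p4; p5; a']); split=> //.
- have tr01 : {in X, forall x, d a (run s 0 x) = d a x} by [].
  case=> [|[|[|[|[|[|i]]]]]]// _; split; try (by move=> x xX;
    rewrite ?p1_tr ?p2_tr ?p3_tr ?p4_tr ?p5_tr ?a'_tr);
    try by [|rewrite metric_sym].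
  + by move=> x xX; rewrite /level map_id_in//; exact: aX.
  + move=> x xX; apply: p1_indep; first exact: T_X.
    exact: indep_mem.
  + apply: neighbours => [x xX|]; first by rewrite /level map_id_in//; exact: aX.
    have [|?|?|] := p1T a; [exact: T_a|left; lra|left|by right].
    by have := mdist_ge0 a a; lra.
  + by move=> x xX; apply: p1_indep; [exact: T_run|exact: aX].
  + by move=> x xX; apply: p2T; exact: T_run.
  + apply: neighbours p2p1 => x xX.
    by apply: p1_indep; [exact: T_run|exact: aX].
  + by move=> x xX; apply: p2T; exact: T_run.
  + by move=> x xX; apply: p3T; exact: T_run.
  + by apply: neighbours p3p2 => x xX; apply: p2T; exact: T_run.
  + by move=> x xX; apply: p3T; exact: T_run.
  + by move=> x xX; apply: p4T; exact: T_run.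
  + by apply: neighbours p4p3 => x xX; apply: p3T; exact: T_run.
  + by move=> x xX; apply: p4T; exact: T_run.
  + by move=> x xX; apply: p5_indep; [exact: T_run|exact: a'X].
  + apply: neighbours => [x xX|]; first by apply: p4T; exact: T_run.
    have [|?|?|?|] := p5T p4; [by rewrite inE eqxx|left; lra|left|left|by right].
      by have := mdist_ge0 p4 p4; lra.
    by have := mdist_ge0 a' p4; lra.
  + by move=> x xX; apply: p5_indep; [exact: T_run|exact/indep_mem/lvl].
  + by move=> x xX; exact: a'X.
  + have [|?|?|?|[y yX le_y]] := p5T a'; first by rewrite inE T_a' orbT.
    - by left; lra.
    - by left; have := mdist_ge0 p4 a'; lra.
    - by left; have := mdist_ge0 a' a'; lra.
    have [far|[_ /mapP[x xX ->] le_x]] := a'X 5%N y isT yX.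
      rewrite metric_sym in far.
      by left; have := mdist_ge0 p5 (run s 5 y); lra.
    right; exists y, x; split=> //.
    by rewrite (metric_sym (run s 5 y) (run s 6 x)) (metric_sym (run s 6 x) a');
       rewrite (metric_sym (run s 5 y) a') in le_y; lra.
- have via i p z : (1 <= i <= 2)%N -> z \in a' :: level X s 6 ->
      indep (level X s i) p z -> indep (a :: X) p z.
    move=> i12 zE /indepC pz.
    apply: (@indepS _ _ X) => [x xX|]; first by rewrite inE xX orbT.
    apply: indepC; apply: indep_trans pz _ => _ /mapP[x xX ->]; apply: indepC.
    move: zE; rewrite inE => /orP[/eqP->|/mapP[w wX ->]]; last exact: s12.
    by have [] := free12 i12 xX.
  have inT z : z \in a' :: level X s 6 -> z \in T.
    by rewrite inE => /orP[/eqP->|/mapP[w wX ->]]//; exact: T_run.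
  case=> [|[|[|i]]]// _ z zE /=; last by apply: (via 2%N) => //; exact/p2T/inT.
  have [?|?|[x xX ?]] := p1T z (inT _ zE); first by left.
    by right; exists a; rewrite ?inE ?eqxx//; lra.
  by apply: (via 1%N) => //; right; exists (run s 1 x) => //; exact: map_f.
have via i p z : (4 <= i <= 5)%N -> z \in a :: X ->
    indep (level X s i) p z -> indep (a' :: level X s 6) p z.
  move=> i45 zE /indepC pz.
  apply: (@indepS _ _ (level X s 6)) => [x xX|]; first by rewrite inE xX orbT.
  apply: indepC; apply: indep_trans pz _ => _ /mapP[x xX ->]; apply: indepC.
  move: zE; rewrite inE => /orP[/eqP->|zX]; last exact: s45.
  by have [] := free45 i45 xX.
have inT z : z \in a :: X -> z \in T.
  by rewrite inE => /orP[/eqP->|/T_X].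
case=> [|[|[|[|[|[|i]]]]]]// _ z zE /=; first by apply: (via 4%N) => //; exact/p4T/inT.
have [|?] := p5_cases z (inT _ zE); first exact: (via 5%N).
by right; exists a'; rewrite ?inE ?eqxx//; lra.
Qed.

Lemma orbit_realized : exists s', [/\ conj_over A s s', ready A (a :: X) s',
  {in X, run s' 6 =1 run s 6} & run s' 6 a = a'].
Proof.
have [sA s12 s45] := s_ready.
have [p [p0 p6 p_step p12 p45]] := chain_points.
have /choice[k kP] i : exists k : isom U, [/\ {in A, forall x, k x = x},
    {in level X s i ++ level X s i.+1, forall x, k x = x} &
    (i < 6)%N -> (s i ^ k)%g (p i) = p i.+1].
  have [i6|i6] := leqP 6 i; first by exists 1%g; split=> //; rewrite ltnNge i6.
  have [p_tr pX pX' pp' pp'_free] := p_step i i6.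
  have lvlS : level X s i.+1 = [seq s i x | x <- level X s i].
    by rewrite /level -map_comp.
  have [||||| k [kX kp]] := @step_through (s i) (level X s i) (p i) (p i.+1) (s_half i) => //.
  - by move=> _ /mapP[x xX ->]; rewrite -runS p_tr.
  - by move=> _ /mapP[x xX ->]; exact: pX.
  - by rewrite -lvlS => _ /mapP[x xX ->]; exact: pX'.
  - case: pp'_free => [|[x [y [xX yX le_xy]]]]; [by left|right].
    by exists (run s i x), (run s i y); rewrite !map_f// -runS.
  exists k; split=> //; last by rewrite lvlS.
  by move=> x /(sA i (ltnW i6)) xi; rewrite kX// mem_cat xi.
pose s' i := (s i ^ k i)%g.
have s'X i : {in X, run s' i =1 run s i}.
  elim: i => // i IH x xX; have [_ kX _] := kP i.
  rewrite !runS IH// /s' isomJ kX ?mem_cat ?map_f// -runS.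
  by rewrite (fix_isomV kX)// mem_cat (map_f (run s i.+1)) ?orbT.
have s'a i : (i <= 6)%N -> run s' i a = p i.
  elim: i => // i IH i6; have [_ _ kp] := kP i.
  by rewrite runS IH ?(ltnW i6)//; exact: kp.
have lvl6 : level (a :: X) s' 6 = a' :: level X s 6.
  by rewrite /level map_cons s'a// p6; congr (_ :: _); apply/eq_in_map/s'X.
have subX : {subset X <= a :: X} by move=> x xX; rewrite inE xX orbT.
have sub6 : {subset level X s 6 <= a' :: level X s 6}.
  by move=> x xX; rewrite inE xX orbT.
exists s'; split; last by rewrite s'a.
- by move=> i; exists (k i) => //; have [] := kP i.
- split.
  + move=> i i6 x /(sA i i6)/mapP[y yX ->]; apply/mapP; exists y; first exact: subX.
    by rewrite s'X.
  + move=> i i12 x z xX zX.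
    have zE : run s' 6 z \in a' :: level X s 6 by rewrite -lvl6 map_f.
    have i6 : (i <= 6)%N by case/andP: i12 => _ /leq_trans->.
    move: xX; rewrite inE => /orP[/eqP->|xX]; first by rewrite s'a//; exact: p12.
    rewrite s'X//; apply: indepS subX _.
    move: zE; rewrite inE => /orP[/eqP->|/mapP[w wX ->]]; last exact: s12.
    by have [] := free12 i12 xX.
  + rewrite lvl6 => i i45 x z xX zX.
    have i6 : (i <= 6)%N by case/andP: i45 => _ /leq_trans->.
    move: xX; rewrite inE => /orP[/eqP->|xX]; first by rewrite s'a//; exact: p45.
    rewrite s'X//; apply: indepS sub6 _.
    move: zX; rewrite inE => /orP[/eqP->|zX]; last exact: s45.
    by have [] := free45 i45 xX.
- exact: s'X.
Qed.

End NewOrbit.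

Lemma prescribe_one A X s a a' : (forall i, half_isom (s i)) -> ready A X s ->
    {in X, forall x, d a' (run s 6 x) = d a x} ->
  exists s', [/\ conj_over A s s', ready A (a :: X) s',
    {in X, run s' 6 =1 run s 6} & run s' 6 a = a'].
Proof.
move=> s_half s_ready aa'.
have [s1 [ss1 s1_ready s1X s1_12 s1_45]] := interior_moved a a' s_ready.
have [|s2 [s12 s2_ready s2X s2a]] :=
    orbit_realized (conj_over_half ss1 s_half) s1_ready _ s1_12 s1_45.
  by move=> x xX; rewrite s1X// aa'.
exists s2; split=> //; first exact: conj_over_trans ss1 s12.
by move=> x xX; rewrite s2X// s1X.
Qed.

(** New points are added to a ready chain one at a time. *)
Lemma prescribe A X X' s (w : isom U) : (forall i, half_isom (s i)) -> ready A X s ->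
    {in X, w =1 run s 6} ->
  exists s', conj_over A s s' /\ {in X', run s' 6 =1 isom_fun w}.
Proof.
move=> s_half s_ready wX.
suff [s' [ss' _ s'w]] : exists s', [/\ conj_over A s s', ready A (X' ++ X) s' &
    {in X' ++ X, run s' 6 =1 isom_fun w}].
  by exists s'; split=> // x xX'; rewrite s'w// mem_cat xX'.
elim: X' => [|a X' [s' [ss' s'_ready s'w]]].
  by exists s; split=> //; [exact: conj_over_refl|move=> x /wX].
have [|s2 [s's2 s2_ready s2X s2a]] :=
    @prescribe_one A (X' ++ X) s' a (w a) (conj_over_half ss' s_half) s'_ready.
  by move=> x xX; rewrite s'w// dist_isom.
exists s2; split=> //; first exact: conj_over_trans ss' s's2.
by move=> x; rewrite inE => /orP[/eqP->//|xX]; rewrite s2X// s'w.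
Qed.

Lemma ready_exists A s : (forall i, half_isom (s i)) ->
  exists s' X, conj_over A s s' /\ ready A X s'.
Proof.
move=> s_half; have [s1 [ss1 s1_indep]] := consecutive_indep_exists hU A s 6.
pose X := [seq ((run s1 i)^-1)%g x | i <- iota 0 7, x <- A].
have s1A : anchored A X s1 6.
  move=> i i6 x xA; apply/mapP; exists ((run s1 i)^-1%g x); last by rewrite isomVK.
  by apply/allpairsP; exists (i, x); rewrite mem_iota.
have steps i : (i <= 6)%N -> exists s', [/\ conj_over A s s',
    anchored A X s' 6, consecutive_indep A s' 6 &
    forall j, (j < i)%N -> generic_step A X s' j].
  elim: i => [|i IH] i6; first by exists s1; split.
  have [s2 [ss2 s2A s2_indep s2_gen]] := IH (ltnW i6).
  have [s3 [s23 s3A s3_indep s3_gen]] :=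
    generic_next hU i6 (conj_over_half ss2 s_half) s2A s2_indep s2_gen.
  by exists s3; split=> //; exact: conj_over_trans ss2 s23.
have [s' [ss' s'A s'_indep s'_gen]] := steps 6%N isT.
have AX : {subset A <= X} by move=> x /(s'A 0%N isT)/mapP[y yX ->].
exists s', X; split=> //; split=> // i /andP[i1 i2] x z xX zX.
  have i46 : (i + 4 <= 6)%N by rewrite (leq_add2r 4 i 2).
  by apply: indepS AX _; exact: (decay s'_indep s'_gen i46).
apply: (@indepS _ _ A); first exact: s'A.
have i6 : (i <= 6)%N by rewrite (leq_trans i2).
by apply: indepC; exact: (decay s'_indep s'_gen (i := 0) i1 i6 zX xX).
Qed.

End Prescribing.

(** * Every isometry is a product of conjugates *)

Section Products.
Context {R : realType} {U : metricType R}.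
Variable hU : is_bounded_urysohn U.
Variable g : isom U.
Variable g_half : half_isom g.
Implicit Types (x y z : U) (f k w : isom U) (A B X E : seq U).
Implicit Types (h u v : nat -> isom U).

Definition product h : isom U := run (fun i => g ^ h i)%g 6.

Definition agree A h h' := forall i, {in A, h' i =1 h i}.

Lemma agree_trans A h h' h'' : agree A h h' -> agree A h' h'' -> agree A h h''.
Proof. by move=> hh' h'h'' i x xA; rewrite h'h''// hh'. Qed.

Lemma agreeS A B h h' : {subset A <= B} -> agree B h h' -> agree A h h'.
Proof. by move=> AB hh' i x /AB; exact: hh'. Qed.

Lemma run_eq (s s' : nat -> isom U) n : s =1 s' -> run s n = run s' n.
Proof. by move=> ss'; elim: n => //= n ->; rewrite ss'. Qed.

Lemma conj_over_agree A h (s : nat -> isom U) : conj_over A (fun i => g ^ h i)%g s ->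
  exists h', agree A h h' /\ (fun i => g ^ h' i)%g =1 s.
Proof.
move=> hs; have /choice[k kP] i : exists k : isom U,
    {in A, forall x, k x = x} /\ s i = ((g ^ h i) ^ k)%g.
  by have [k kA sE] := hs i; exists k.
exists (fun i => h i * k i)%g; split=> [i x xA|i].
  by have [kA _] := kP i; rewrite [LHS]/= kA.
by have [_ ->] := kP i; rewrite conjgM.
Qed.

(** The values of the product on finitely many points involve the conjugators
    on finitely many points only. *)
Lemma product_local h X : exists A, forall h',
  agree A h h' -> {in X, product h' =1 product h}.
Proof.
pose s i := (g ^ h i)%g.
exists [seq run s i x | i <- iota 0 7, x <- X] => h' hh' x xX.
suff runE : forall i, (i <= 6)%N -> run (fun i => g ^ h' i)%g i x = run s i x.
  exact: (runE 6%N).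
have h'E i : (i <= 6)%N -> forall j, h' j (run s i x) = h j (run s i x).
  move=> i6 j; apply: hh'; apply/allpairsP; exists (i, x).
  by rewrite mem_iota.
elim=> // i IH i6; have i6' := ltnW i6.
rewrite !runS IH// /s !isomJ -/s h'E//; apply: (@isom_inj _ _ (h' i)).
have := h'E _ i6 i; rewrite runS {1 3}/s isomJ -/s => ->.
by rewrite !isomVK.
Qed.

(** In the topology of pointwise convergence: the image under [product] of the
    neighbourhood of [h] given by [A] is dense in the neighbourhood of [w] given
    by [X]. *)
Definition dense_near A h X w := forall w', {in X, w' =1 w} -> forall E,
  exists h', agree A h h' /\ {in E, product h' =1 w'}.

Lemma dense_nearS A h X X' w : {subset X <= X'} ->
  dense_near A h X w -> dense_near A h X' w.
Proof. by move=> XX' hX w' w'w; apply: hX => x /XX'; exact: w'w. Qed.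

Lemma dense_near_ready A h X : ready A X (fun i => g ^ h i)%g ->
  dense_near A h X (product h).
Proof.
move=> h_ready w ww E; have gh_half i : half_isom (g ^ h i)%g by exact: half_isomJ.
have [s [hs sw]] := prescribe hU E gh_half h_ready ww.
have [h' [hh' h's]] := conj_over_agree hs.
by exists h'; split=> // x xE; rewrite /product (run_eq _ h's) sw.
Qed.

Lemma dense_near_exists A h : exists h' X,
  agree A h h' /\ dense_near A h' X (product h').
Proof.
have [i|s [X [hs s_ready]]] := @ready_exists _ _ hU A (fun i => g ^ h i)%g.
  exact: half_isomJ.
have [h' [hh' h's]] := conj_over_agree hs.
exists h', X; split=> //; apply: dense_near_ready.
by rewrite (_ : (fun i => _) = s)//; apply/funext.
Qed.

(** State of the alternating construction: the products of [u] and [v] are to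
    become [w] and [f * w] for a common [w]; they do so on [X], where the product
    of [u] can still be extended at will. *)
Let state f A u v X :=
  dense_near A u X (product u) /\ {in X, product v =1 (f * product u)%g}.

(** Freeze [v] on [B], bring it into general position, and let [u] follow: the
    roles of [u] and [v] are exchanged. *)
Let half_turn f A u v X B E : state f A u v X ->
  exists C u' v' X', [/\ {subset B <= C}, agree C v v', agree A u u',
    {subset X ++ E <= X'} & state (f^-1)%g C v' u' X'].
Proof.
move=> [uX vX]; have [B' B'P] := product_local v X.
have [v' [X1 [vv' v'X1]]] := dense_near_exists (B ++ B') v.
have v'v : {in X, product v' =1 product v}.
  by apply: B'P; apply: agreeS vv' => x xB'; rewrite mem_cat xB' orbT.
have [|u' [uu' u'X]] := uX (f^-1 * product v')%g _ (X1 ++ X ++ E).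
  by move=> x xX; rewrite isomM v'v// vX// isomK.
exists (B ++ B'), u', v', (X1 ++ X ++ E); split=> //.
- by move=> x xB; rewrite mem_cat xB.
- by move=> x xXE; rewrite mem_cat xXE orbT.
- by split=> //; apply: dense_nearS v'X1 => x xX1; rewrite mem_cat xX1.
Qed.

(** Freezing [h] on this set puts [y] both in the domain and in the range of the
    frozen part of every [h i]. *)
Let around y h := y :: [seq (h i)^-1%g y | i <- iota 0 6].

Let around_agree y A h h' i : {subset around y h <= A} -> agree A h h' ->
  (i < 6)%N -> y \in A /\ (h' i)^-1%g y \in A.
Proof.
move=> hA hh' i6; split; first by apply: hA; rewrite inE eqxx.
have hi : (h i)^-1%g y \in A.
  by apply: hA; rewrite inE (map_f (fun i => (h i)^-1%g y)) ?orbT// mem_iota.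
suff -> : (h' i)^-1%g y = (h i)^-1%g y by [].
by apply: (@isom_inj _ _ (h' i)); rewrite isomVK hh'// isomVK.
Qed.

Let limit_of (h : nat -> nat -> isom U) (A : nat -> seq U) (s : nat -> U) :
    (forall x (e : R), 0 < e -> exists n, d x (s n) <= e) ->
    (forall n, {subset A n <= A n.+1}) ->
    (forall n, agree (A n) (h n) (h n.+1)) ->
    (forall n i, (i < 6)%N -> s n \in A n.+1 /\ (h n.+1 i)^-1%g (s n) \in A n.+1) ->
  exists h', isom_lim (fun n => product (h n)) (product h').
Proof.
move=> s_dense A_incr hA sA.
have /choice[h' h'P] i : exists f, (i < 6)%N -> isom_lim (fun n => h n i) f.
  have [i6|i6] := leqP 6 i; first by exists 1%g.
  have [|||f fP] := @isom_limit _ _ hU (fun n => h n i) A s s_dense A_incr.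
  - by move=> n; exact: hA.
  - by move=> n; have [] := sA n i i6.
  - by move=> n; have [] := sA n i i6.
  - by exists f.
exists h'; suff lim i : (i <= 6)%N ->
    isom_lim (fun n => run (fun j => g ^ h n j)%g i) (run (fun j => g ^ h' j)%g i).
  exact: lim.
elim: i => [|i IH] i6; first exact: isom_lim_cst.
apply: isom_limM; last exact/IH/ltnW.
rewrite conjgE; apply: isom_limM; first exact/isom_limV/h'P.
by apply: isom_limM; [exact: isom_lim_cst|exact: h'P].
Qed.

(** Turn by turn [u] and [v] converge, and so do their products. *)
Lemma quotient_of_products f : exists u v, f = (product v * (product u)^-1)%g.
Proof.
have [s s_dense] := dense_sequence hU.
pose T := ((nat -> isom U) * seq U * ((nat -> isom U) * seq U) * seq U)%type.
pose U_ (t : T) := t.1.1.1; pose A_ (t : T) := t.1.1.2.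
pose V_ (t : T) := t.1.2.1; pose B_ (t : T) := t.1.2.2; pose X_ (t : T) := t.2.
pose good (t : T) := state f (A_ t) (U_ t) (V_ t) (X_ t).
pose Q n (t t' : {t | good t}) := let: t := sval t in let: t' := sval t' in
  [/\ {subset A_ t <= A_ t'}, agree (A_ t) (U_ t) (U_ t'),
      {subset B_ t <= B_ t'}, agree (B_ t) (V_ t) (V_ t') &
      [/\ forall i, (i < 6)%N -> s n \in A_ t' /\ (U_ t' i)^-1%g (s n) \in A_ t',
      forall i, (i < 6)%N -> s n \in B_ t' /\ (V_ t' i)^-1%g (s n) \in B_ t',
      s n \in X_ t' & {subset X_ t <= X_ t'}]].
have turn n t : exists t', Q n t t'.
  case: t => [[[[u A] [v B]] X] uvX].
  have [C [u1 [v1 [X1 [BC vv1 uu1 XX1 vuX]]]]] :=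
    half_turn (B ++ around (s n) v) [:: s n] uvX.
  have [D [v2 [u2 [X2 [AD u12 v12 X12 uvX2]]]]] :=
    half_turn (A ++ around (s n) u1) [::] vuX.
  rewrite invgK in uvX2.
  exists (exist _ (u2, D, (v2, C), X2) uvX2); split=> /=.
  - by move=> x xA; apply: AD; rewrite mem_cat xA.
  - apply: agree_trans uu1 _; apply: agreeS u12 => x xA.
    by apply: AD; rewrite mem_cat xA.
  - by move=> x xB; apply: BC; rewrite mem_cat xB.
  - apply: (@agreeS _ C); last exact: agree_trans vv1 v12.
    by move=> x xB; apply: BC; rewrite mem_cat xB.
  split.
  - by move=> i; apply: (around_agree _ u12) => x xa; apply: AD; rewrite mem_cat xa orbT.
  - move=> i; apply: (around_agree _ (agree_trans vv1 v12)) => x xa.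
    by apply: BC; rewrite mem_cat xa orbT.
  - apply: X12; rewrite mem_cat XX1// mem_cat inE eqxx orbT//.
  - by move=> x xX; apply: X12; rewrite mem_cat XX1// mem_cat xX.
have start : good ((fun=> 1%g, [::]), (fun=> 1%g, [::]), [::]).
  by split=> //; apply: dense_near_ready; split.
have [F [_ FQ]] := exists_sequence (exist good _ start) turn.
pose t n := sval (F n).
have {}FQ n : Q n (F n) (F n.+1) by exact: FQ.
have [|||u u_lim] := @limit_of (fun n => U_ (t n)) (fun n => A_ (t n)) s s_dense;
  try by move=> n; have [? ? ? ? []] := FQ n.
have [|||v v_lim] := @limit_of (fun n => V_ (t n)) (fun n => B_ (t n)) s s_dense;
  try by move=> n; have [? ? ? ? []] := FQ n.
have X_s n m : (n < m)%N -> s n \in X_ (t m).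
  elim: m => // m IH; rewrite ltnS leq_eqVlt => /orP[/eqP<-|/IH sm].
    by have [_ _ _ _ []] := FQ n.
  by have [_ _ _ _ [_ _ _]] := FQ m; apply.
exists u, v; suff -> : product v = (f * product u)%g by rewrite mulgK.
apply: isom_eq_dense s_dense _ => n.
apply: point_lim_unique (v_lim (s n)) _.
have fu_lim := isom_limM (isom_lim_cst f) u_lim.
move=> e /(fu_lim (s n))[N NP]; exists (maxn N n.+1) => m.
rewrite geq_max => /andP[/NP le_e nm].
by have [_ /(_ _ (X_s _ _ nm)) vfu] := svalP (F m); rewrite -vfu in le_e.
Qed.

Lemma products_in_normal (N : set (isom U)) h :
  normal_subgroup N -> N g -> N (product h).
Proof.
move=> [[N1 NM _] NJ] Ng; rewrite /product; elim: 6%N => //= n IH.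
by apply: NM => //; exact: NJ.
Qed.

End Products.

Theorem theorem1p1 (R : realType) (U : metricType R) (hU : is_bounded_urysohn U) :
  simple_group (isom U).
Proof.
split=> [|N N_normal].
  have [a _] := @free_point _ _ hU [::] [::] (fun _ _ => ltac:(by [])).
  have [b [_ bZ]] := @free_point _ _ hU [::] [:: a] (fun _ _ => ltac:(by [])).
  have [|ba|[]//] := bZ a; first by rewrite inE.
  have [|k [_ ka]] := @isom_extend _ _ hU [::] 1%g a b; first by [].
  by exists k => k1; move: ba; rewrite -ka k1 mdistxx ler10.
have [->|N_neq1] := pselect (N = [set 1%g]); first by left.
right; apply/seteqP; split => // f _.
have [g [Ng g_half g_att]] := normal_half_isom hU N_normal N_neq1.
have [u [v ->]] := quotient_of_products hU (conj g_half g_att) f.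
have [[_ NM NV] _] := N_normal.
by apply: NM; [|apply: NV]; exact: products_in_normal.
Qed.
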